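(* Let $K$ be an algebraically closed field and let $A$ be one of the algebras $\Lambda_1'$ or $\Lambda_2'$. Then: (i) $\dim_K HH^0(A)=5$. (ii) $\dim_K HH^1(A)=3$ if $\mathrm{char}(K)\neq 3$, and $\dim_K HH^1(A)=4$ if $\mathrm{char}(K)=3$. (iii) $\dim_K HH^2(A)=3$ if $\mathrm{char}(K)\neq 3$, and $\dim_K HH^2(A)=4$ if $\mathrm{char}(K)=3$.
   Context: For a finite-dimensional $K$-algebra $A$, $HH^n(A)=\mathrm{Ext}^n_{A^e}(A,A)$ with $A^e=A^{\mathrm{op}}\otimes_K A$ is the $n$-th Hochschild cohomology space. Paths are composed from left to right ($\alpha\beta$ means first $\alpha$, then $\beta$). Let $Q$ be the quiver with vertices $1,2$ and arrows $\alpha:2\to2$, $\gamma:2\to1$, $\beta:1\to2$. $\Lambda_1'$ is the bound quiver algebra of $Q$ with relations $\alpha^2=\gamma\beta$, $\beta\alpha\gamma=0$. $\Lambda_2'$ is the bound quiver algebra of $Q$ with relations $\alpha^2\gamma=0$, $\beta\alpha^2=0$, $\beta\gamma=0$, $\alpha^3=\gamma\beta$. *)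

(* Defs.v *)
From HB Require Import structures.
From mathcomp Require Import all_boot all_order all_algebra all_field.
From mathcomp Require Import finmap.
From mathcomp.multinomials Require Import monalg.

Set Implicit Arguments.
Unset Strict Implicit.
Unset Printing Implicit Defensive.

Import GRing.Theory.
Local Open Scope ring_scope.

(** * Ext of left modules over a K-algebra *)

Section Ext.
Variables (K : fieldType) (R : algType K).

Definition projective (P : lmodType R) : Prop :=
  forall (M N : lmodType R) (g : {linear M -> N}) (f : {linear P -> N}),
    (forall y, exists x, g x = y) ->
    exists h : {linear P -> M}, forall x, g (h x) = f x.

Record projective_resolution (M : lmodType R) := ProjectiveResolution {
  res_mod :> nat -> lmodType R;
  res_d : forall n, {linear res_mod n.+1 -> res_mod n};
  res_aug : {linear res_mod 0%N -> M};
  res_projective : forall n, projective (res_mod n);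
  res_aug_surj : forall y, exists x, res_aug x = y;
  res_exact0 : forall x, res_aug x = 0 <-> exists y, res_d 0%N y = x;
  res_exact : forall n x, res_d n x = 0 <-> exists y, res_d n.+1 y = x
}.

Variables (M N : lmodType R).

Definition cocycle (P : projective_resolution M) n (f : P n -> N) : Prop :=
  forall x, f (res_d P n x) = 0.

Definition coboundary (P : projective_resolution M) n : (P n -> N) -> Prop :=
  match n with
  | 0 => fun f => forall x, f x = 0
  | m.+1 => fun f => exists g : {linear P m -> N}, forall x, f x = g (res_d P m x)
  end.

(** The n-th cohomology of the complex of K-spaces Hom_R(P, N) has dimension d:
    it has a basis formed by the classes of d cocycles b_i, i.e. every cocycle
    is, modulo coboundaries, a unique K-linear combination of the b_i. *)
Definition cohomology_dim (P : projective_resolution M) (n d : nat) : Prop :=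
  exists2 b : 'I_d -> {linear P n -> N},
    forall i, cocycle (b i) &
    forall f : {linear P n -> N}, cocycle f ->
      exists! c : 'rV[K]_d,
        coboundary (fun x => f x - \sum_i (c 0 i)%:A *: b i x).

(** dim_K Ext^n_R(M, N) = d.  The first conjunct prevents the second one from
    holding vacuously. *)
Definition Ext_dim (n d : nat) : Prop :=
  inhabited (projective_resolution M) /\
  forall P : projective_resolution M, cohomology_dim P n d.

End Ext.

(** * Opposite algebra and tensor product of finite-dimensional algebras *)

(* MathComp only provides the ring structure of A^c. *)
HB.instance Definition _ (K : fieldType) (A : vectType K) := Vector.on A^c.

Section OppositeAlgebra.
Variables (K : fieldType) (A : falgType K).

Fact converse_scalerAl (k : K) (x y : A^c) :
  k *: (x * y : A^c) = (k *: x : A^c) * y :> A^c.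
Proof. exact: (@scalerAr K A k y x). Qed.
HB.instance Definition _ :=
  GRing.Lmodule_isLalgebra.Build K A^c converse_scalerAl.

Fact converse_scalerAr (k : K) (x y : A^c) :
  k *: (x * y : A^c) = x * (k *: y : A^c) :> A^c.
Proof. exact: (@scalerAl K A k y x). Qed.
HB.instance Definition _ :=
  GRing.Lalgebra_isAlgebra.Build K A^c converse_scalerAr.

End OppositeAlgebra.

Section TensorSpace.
Variables (K : fieldType) (A B : vectType K).

(** With e_i and f_j the bases [vbasis {:A}] and [vbasis {:B}], the matrix X
    stands for the tensor \sum_(i, j) X i j (e_i (x) f_j). *)
Definition tensor : Type := 'M[K]_(\dim {:A}, \dim {:B}).
HB.instance Definition _ := GRing.Lmodule.on tensor.

Definition tens (a : A) (b : B) : tensor :=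
  \matrix_(i, j) (coord (vbasis {:A}) i a * coord (vbasis {:B}) j b).

(** The linear map a (x) b |-> F a b, when F is bilinear. *)
Definition tensor_lift (V : lmodType K) (F : A -> B -> V) (X : tensor) : V :=
  \sum_i \sum_j X i j *: F (vbasis {:A})`_i (vbasis {:B})`_j.

Lemma tensor_lift_is_linear (V : lmodType K) (F : A -> B -> V) :
  linear (tensor_lift F).
Proof.
move=> k X Y; rewrite /tensor_lift scaler_sumr -big_split; apply: eq_bigr => i _.
rewrite scaler_sumr -big_split; apply: eq_bigr => j _ /=.
by rewrite !mxE scalerDl scalerA.
Qed.
HB.instance Definition _ (V : lmodType K) (F : A -> B -> V) :=
  GRing.isLinear.Build K tensor V *:%R (tensor_lift F)
    (tensor_lift_is_linear F).

Lemma tensor_lift_combination (V : lmodType K) k (F F1 F2 : A -> B -> V) X :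
    (forall a b, F a b = k *: F1 a b + F2 a b) ->
  tensor_lift F X = k *: tensor_lift F1 X + tensor_lift F2 X.
Proof.
move=> eqF; rewrite /tensor_lift scaler_sumr -big_split; apply: eq_bigr => i _.
rewrite scaler_sumr -big_split; apply: eq_bigr => j _ /=.
by rewrite eqF scalerDr !scalerA mulrC.
Qed.

Lemma tensor_lift_tens (V : lmodType K) (F : A -> B -> V) a b :
    (forall y, linear (F^~ y)) -> (forall x, linear (F x)) ->
  tensor_lift F (tens a b) = F a b.
Proof.
move=> linl linr.
pose Fl y : {linear A -> V} :=
  HB.pack (F^~ y) (GRing.isLinear.Build K A V *:%R (F^~ y) (linl y)).
pose Fr x : {linear B -> V} :=
  HB.pack (F x) (GRing.isLinear.Build K B V *:%R (F x) (linr x)).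
rewrite -[RHS]/(Fl b a) [in RHS](coord_vbasis (memvf a)) linear_sum.
apply: eq_bigr => i _; rewrite linearZ /= -[F _ b]/(Fr _ b).
rewrite [in RHS](coord_vbasis (memvf b)) linear_sum scaler_sumr.
by apply: eq_bigr => j _; rewrite linearZ /= mxE scalerA.
Qed.

Lemma tens_linl b : linear (tens^~ b).
Proof.
by move=> k x y; apply/matrixP=> i j; rewrite !mxE linearP mulrDl mulrA.
Qed.

Lemma tens_linr a : linear (tens a).
Proof.
by move=> k x y; apply/matrixP=> i j; rewrite !mxE linearP mulrDr mulrCA.
Qed.

Lemma tensor_ind (P : tensor -> Prop) :
    (forall k X Y, P X -> P Y -> P (k *: X + Y)) -> P 0 ->
    (forall a b, P (tens a b)) ->
  forall X, P X.
Proof.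
move=> Plin P0 Ptens X.
have PD Y Z : P Y -> P Z -> P (Y + Z) by move=> ? ?; rewrite -[Y]scale1r; exact: Plin.
have -> : X = \sum_i \sum_j X i j *: tens (vbasis {:A})`_i (vbasis {:B})`_j.
  apply/matrixP=> i j; rewrite summxE (bigD1 i) //= [X in _ + X]big1 => [|i' ne].
    rewrite addr0 summxE (bigD1 j) //= [X in _ + X]big1 => [|j' ne].
      by rewrite addr0 !mxE !coord_free ?(basis_free (vbasisP _)) // !eqxx !mulr1.
    by rewrite !mxE !coord_free ?(basis_free (vbasisP _)) // -!val_eqE /= in ne *;
       rewrite (negPf ne) !mulr0.
  rewrite summxE big1 // => j' _.
  rewrite !mxE !coord_free ?(basis_free (vbasisP _)) //.
  by rewrite -!val_eqE /= in ne *; rewrite (negPf ne) mul0r mulr0.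
by do 2![apply: big_ind => // ? _]; rewrite -[_ *: _]addr0; apply: Plin.
Qed.

End TensorSpace.

Section TensorAlgebra.
Variables (K : fieldType) (A B : falgType K).
Local Notation T := (tensor A B).

(** (a (x) b) (a' (x) b') = aa' (x) bb', see [tensor_mul_tens]. *)
Definition tensor_mul (X Y : T) : T :=
  tensor_lift
    (fun a b => tensor_lift (fun a' b' => tens (a * a') (b * b')) Y) X.

Lemma tensor_mul_linl Y : linear (tensor_mul^~ Y).
Proof. by move=> k X X'; rewrite /tensor_mul linearP. Qed.

Lemma tensor_mul_linr X : linear (tensor_mul X).
Proof.
move=> k Y Y'; apply: tensor_lift_combination => a b.
exact: tensor_lift_is_linear.
Qed.

Lemma tensor_mul_tens a b a' b' :
  tensor_mul (tens a b) (tens a' b') = tens (a * a') (b * b').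
Proof.
have inner x y : tensor_lift (fun u v => tens (x * u) (y * v)) (tens a' b')
    = tens (x * a') (y * b') :> T.
  rewrite tensor_lift_tens // => [v|u] k w w'; rewrite mulrDr -scalerAr.
    exact: tens_linl.
  exact: tens_linr.
rewrite /tensor_mul tensor_lift_tens; first exact: inner.
  by move=> y k u v; rewrite !inner mulrDl -scalerAl tens_linl.
by move=> x k u v; rewrite !inner mulrDl -scalerAl tens_linr.
Qed.

Fact tensor_mulDl : left_distributive tensor_mul +%R.
Proof. by move=> X Y Z; rewrite -[X]scale1r tensor_mul_linl !scale1r. Qed.

Fact tensor_mulDr : right_distributive tensor_mul +%R.
Proof. by move=> X Y Z; rewrite -[Y]scale1r tensor_mul_linr !scale1r. Qed.

Fact tensor_mul0l Y : tensor_mul 0 Y = 0.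
Proof. by apply: (addrI (tensor_mul 0 Y)); rewrite -tensor_mulDl !addr0. Qed.

Fact tensor_mul0r X : tensor_mul X 0 = 0.
Proof. by apply: (addrI (tensor_mul X 0)); rewrite -tensor_mulDr !addr0. Qed.

Fact tensor_mulA : associative tensor_mul.
Proof.
move=> X Y Z; elim/tensor_ind: X => [k X X' IH IH'||a b].
- by rewrite !tensor_mul_linl IH IH'.
- by rewrite !tensor_mul0l.
elim/tensor_ind: Y => [k Y Y' IH IH'||a' b'].
- by rewrite !(tensor_mul_linl, tensor_mul_linr) IH IH'.
- by rewrite tensor_mul0l !tensor_mul0r tensor_mul0l.
elim/tensor_ind: Z => [k Z Z' IH IH'||a'' b''].
- by rewrite !tensor_mul_linr IH IH'.
- by rewrite !tensor_mul0r.
by rewrite !tensor_mul_tens !mulrA.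
Qed.

Fact tensor_mul1l : left_id (tens 1 1) tensor_mul.
Proof.
elim/tensor_ind=> [k X Y IH IH'||a b]; first by rewrite tensor_mul_linr IH IH'.
  exact: tensor_mul0r.
by rewrite tensor_mul_tens !mul1r.
Qed.

Fact tensor_mul1r : right_id (tens 1 1) tensor_mul.
Proof.
elim/tensor_ind=> [k X Y IH IH'||a b]; first by rewrite tensor_mul_linl IH IH'.
  exact: tensor_mul0l.
by rewrite tensor_mul_tens !mulr1.
Qed.

Fact tensor_one_neq0 : tens 1 1 != 0 :> T.
Proof.
have coord1 (C : falgType K) : exists i, coord (vbasis {:C}) i 1 != 0.
  apply/existsP; apply: contraT; rewrite negb_exists => /forallP c0.
  have := oner_neq0 C; rewrite [X in X != 0](coord_vbasis (memvf 1)) big1 ?eqxx //.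
  by move=> i _; rewrite (eqP (negbNE (c0 i))) scale0r.
have [[i ci] [j cj]] := (coord1 A, coord1 B).
apply/eqP=> /matrixP/(_ i j)/eqP; rewrite !mxE mulf_eq0.
by rewrite (negPf ci) (negPf cj).
Qed.

HB.instance Definition _ := GRing.Zmodule_isNzRing.Build T
  tensor_mulA tensor_mul1l tensor_mul1r tensor_mulDl tensor_mulDr
  tensor_one_neq0.

Fact tensor_scalerAl (k : K) (X Y : T) : k *: (X * Y) = k *: X * Y.
Proof.
by rewrite -[in RHS](addr0 (k *: X)) [RHS]tensor_mul_linl tensor_mul0l addr0.
Qed.
HB.instance Definition _ :=
  GRing.Lmodule_isLalgebra.Build K T tensor_scalerAl.

Fact tensor_scalerAr (k : K) (X Y : T) : k *: (X * Y) = X * (k *: Y).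
Proof.
by rewrite -[in RHS](addr0 (k *: Y)) [RHS]tensor_mul_linr tensor_mul0r addr0.
Qed.
HB.instance Definition _ :=
  GRing.Lalgebra_isAlgebra.Build K T tensor_scalerAr.

End TensorAlgebra.

(** * Hochschild cohomology *)

Section Hochschild.
Variables (K : fieldType) (A : falgType K).

Definition enveloping : algType K := tensor A^c A.

(** A as a left A^e-module: (a (x) b) x = b x a, see [env_act_tens]. *)
Definition regular_bimodule : Type := A.
HB.instance Definition _ := GRing.Zmodule.on regular_bimodule.

Definition env_act (X : enveloping) (x : regular_bimodule) : regular_bimodule :=
  tensor_lift (fun (a : A^c) (b : A) => (b * (x : A) * (a : A) : A)) X.

Lemma env_act_linl (x : A) : linear (env_act^~ x : enveloping -> A).
Proof. by move=> k X Y; rewrite /env_act linearP. Qed.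

Lemma env_act_tens (a b x : A) :
  env_act (tens (a : A^c) b) x = b * x * a :> A.
Proof.
rewrite /env_act tensor_lift_tens // => y k u v.
  by rewrite mulrDr -scalerAr.
by rewrite !mulrDl -!scalerAl.
Qed.

Fact env_actDr : right_distributive env_act +%R.
Proof.
move=> X x y; rewrite -[env_act X x]scale1r.
apply: tensor_lift_combination => a b.
by rewrite scale1r mulrDr mulrDl.
Qed.

Fact env_actDl x : {morph env_act^~ x : X Y / X + Y}.
Proof. by move=> X Y; rewrite /env_act linearD. Qed.

Fact env_act1 : left_id 1 env_act.
Proof. by move=> x; rewrite [LHS]env_act_tens mul1r mulr1. Qed.

Fact env_actA X Y x : env_act X (env_act Y x) = env_act (X * Y) x.
Proof.
have act0 z : env_act 0 z = 0 by rewrite /env_act linear0.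
elim/tensor_ind: X => [k X X' IH IH'||a b].
- by rewrite mulrDl -scalerAl env_act_linl IH IH' -env_act_linl.
- by rewrite mul0r !act0.
elim/tensor_ind: Y => [k Y Y' IH IH'||a' b'].
- rewrite mulrDr -scalerAr [in RHS]env_act_linl -IH -IH' env_act_linl.
  by rewrite !env_act_tens mulrDr mulrDl -scalerAr -scalerAl.
- by rewrite mulr0 !act0 env_act_tens mulr0 mul0r.
rewrite !env_act_tens [tens _ _ * _]tensor_mul_tens.
transitivity (b * b' * x * @GRing.mul A a' a : A); first by rewrite !mulrA.
exact/esym/env_act_tens.
Qed.

HB.instance Definition _ := GRing.Zmodule_isLmodule.Build enveloping
  regular_bimodule env_actA env_act1 env_actDr env_actDl.

(** dim_K HH^n(A) = d *)
Definition HH_dim (n d : nat) : Prop :=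
  @Ext_dim K enveloping regular_bimodule regular_bimodule n d.

End Hochschild.

(** * Path algebras and bound quiver algebras *)

Record quiver := Quiver {
  vertex : finType;
  arrow : finType;
  source : arrow -> vertex;
  target : arrow -> vertex
}.

Section Paths.
Variable Q : quiver.

(** [is_path x w]: the arrows of w, read from left to right, compose to a path
    starting at the vertex x (w = [::] being the trivial path at x). *)
Fixpoint is_path (x : vertex Q) (w : seq (arrow Q)) : bool :=
  if w is a :: w' then (source a == x) && is_path (target a) w' else true.

Definition qpath : Type :=
  {p : vertex Q * seq (arrow Q) | is_path p.1 p.2}.
HB.instance Definition _ := Choice.on qpath.

Definition path_start (p : qpath) : vertex Q := (val p).1.
Definition path_arrows (p : qpath) : seq (arrow Q) := (val p).2.
Definition path_end (p : qpath) : vertex Q :=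
  last (path_start p) (map (@target Q) (path_arrows p)).

Definition trivial_path (x : vertex Q) : qpath :=
  exist (fun p => is_path p.1 p.2) (x, [::]) isT.

Fact is_path_arrow (a : arrow Q) : is_path (source a) [:: a].
Proof. by rewrite /= eqxx. Qed.
Definition arrow_path (a : arrow Q) : qpath :=
  exist (fun p => is_path p.1 p.2) (source a, [:: a]) (is_path_arrow a).

(** First p, then q; [None] when q does not start where p ends. *)
Definition path_cat (p q : qpath) : option qpath :=
  if path_end p == path_start q
  then (insub (path_start p, path_arrows p ++ path_arrows q) : option qpath)
  else None.

Lemma is_path_cat x u v : is_path x (u ++ v) =
  is_path x u && is_path (last x (map (@target Q) u)) v.
Proof. by elim: u x => //= a u IH x; rewrite IH andbA. Qed.

Variant path_cat_spec (p q : qpath) : option qpath -> Prop :=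
| PathCatSome r of path_end p = path_start q & path_start r = path_start p
    & path_end r = path_end q & path_arrows r = path_arrows p ++ path_arrows q :
    path_cat_spec p q (Some r)
| PathCatNone of path_end p <> path_start q : path_cat_spec p q None.

Lemma path_catP p q : path_cat_spec p q (path_cat p q).
Proof.
rewrite /path_cat; case: eqP => [epq|]; last by constructor.
case: insubP => [r _ er|]; last first.
  by rewrite is_path_cat (valP p) -/(path_end p) epq (valP q).
have [es ea] : path_start r = path_start p /\
    path_arrows r = path_arrows p ++ path_arrows q.
  by rewrite /path_start /path_arrows er.
constructor=> //; rewrite /path_end es ea map_cat last_cat.
by rewrite -/(path_end p) epq.
Qed.

Lemma qpath_inj p q :
  path_start p = path_start q -> path_arrows p = path_arrows q -> p = q.
Proof.
move=> es ea; apply: val_inj; move: es ea; rewrite /path_start /path_arrows.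
by case: (val p) (val q) => [? ?] [? ?] /= -> ->.
Qed.

Lemma path_catA p q r :
  obind (path_cat p) (path_cat q r) = obind (path_cat^~ r) (path_cat p q).
Proof.
case: (path_catP q r) => [s eqr ss es as_|nqr] /=;
  case: (path_catP p q) => [t epq st et at_|npq] //=.
- case: path_catP => [u eps su eu au|]; last by rewrite ss epq.
  case: path_catP => [v etr sv ev av|]; last by rewrite et eqr.
  congr Some; apply: qpath_inj; first by rewrite su sv st.
  by rewrite au av as_ at_ catA.
- by case: path_catP => // u; rewrite ss => /npq.
- by case: path_catP => // u; rewrite et => /nqr.
Qed.

End Paths.

Definition path_algebra (K : fieldType) (Q : quiver) : Type :=
  {malg K[qpath Q]}.
HB.instance Definition _ K Q := GRing.Lmodule.on (path_algebra K Q).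

HB.lock Definition path_elt K Q (p : qpath Q) : path_algebra K Q := << p >>.

Definition path_mul K Q (p q : qpath Q) : path_algebra K Q :=
  oapp (@path_elt K Q) 0 (path_cat p q).

HB.lock Definition path_alg_mul K Q (x y : path_algebra K Q) :
    path_algebra K Q :=
  \sum_(p <- msupp x) \sum_(q <- msupp y) (x@_p * y@_q) *: path_mul K p q.

Section PathAlgebra.
Variables (K : fieldType) (Q : quiver).
Local Notation path_algebra := (path_algebra K Q).
Local Notation path_elt := (@path_elt K Q).
Local Notation path_mul := (@path_mul K Q).
Local Notation path_alg_mul := (@path_alg_mul K Q).

Definition arrow_elt (a : arrow Q) : path_algebra := path_elt (arrow_path a).

Definition path_alg_one : path_algebra := \sum_v path_elt (trivial_path v).

Definition path_lift (V : lmodType K) (F : qpath Q -> V) (x : path_algebra) : V :=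
  \sum_(p <- msupp x) x@_p *: F p.

Lemma path_liftEw (V : lmodType K) (F : qpath Q -> V) (d : {fset qpath Q})
    (x : path_algebra) :
  (msupp x `<=` d)%fset -> path_lift F x = \sum_(p <- d) x@_p *: F p.
Proof.
move=> sxd; rewrite /path_lift; apply: big_fset_incl => // p _ px.
by rewrite mcoeff_outdom // scale0r.
Qed.

Lemma path_lift_is_linear (V : lmodType K) (F : qpath Q -> V) :
  linear (path_lift F).
Proof.
move=> k x y; pose d := (msupp (k *: x + y) `|` (msupp x `|` msupp y))%fset.
have sub1 : (msupp (k *: x + y) `<=` d)%fset by apply: fsubsetUl.
have sub2 : (msupp x `<=` d)%fset.
  by apply: fsubset_trans (fsubsetUr _ _); apply: fsubsetUl.
have sub3 : (msupp y `<=` d)%fset.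
  by apply: fsubset_trans (fsubsetUr _ _); apply: fsubsetUr.
rewrite (path_liftEw _ sub1) (path_liftEw _ sub2) (path_liftEw _ sub3).
rewrite scaler_sumr -big_split; apply: eq_bigr => p _ /=.
by rewrite mcoeffD mcoeffZ scalerDl scalerA.
Qed.
HB.instance Definition _ (V : lmodType K) (F : qpath Q -> V) :=
  GRing.isLinear.Build K path_algebra V *:%R (path_lift F)
    (path_lift_is_linear F).

Lemma path_lift_elt (V : lmodType K) (F : qpath Q -> V) p :
  path_lift F (path_elt p) = F p.
Proof.
rewrite unlock (path_liftEw _ msuppU_le) big_seq_fset1.
by rewrite mcoeffUU scale1r.
Qed.

Lemma path_alg_ind (P : path_algebra -> Prop) :
    (forall k x y, P x -> P y -> P (k *: x + y)) -> P 0 ->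
    (forall p, P (path_elt p)) ->
  forall x, P x.
Proof.
move=> Plin P0 Ppath x; rewrite (monalgE x).
elim/big_ind: _ => // [y z Py Pz|p _].
  by rewrite -[y]scale1r; apply: Plin.
have -> : << x@_p *g p >> = x@_p *: path_elt p + 0.
  rewrite addr0; apply/malgP => q.
  by rewrite [LHS]mcoeffU [RHS]mcoeffZ unlock mcoeffU mulr_natr.
exact: Plin.
Qed.

Lemma path_alg_mulE x y :
  path_alg_mul x y = path_lift (fun p => path_lift (path_mul p) y) x.
Proof.
rewrite unlock; apply: eq_bigr => p _; rewrite scaler_sumr.
by apply: eq_bigr => q _; rewrite scalerA.
Qed.

Lemma path_alg_mul_linl y : linear (path_alg_mul^~ y).
Proof. by move=> k x x'; rewrite !path_alg_mulE linearP. Qed.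

Lemma path_alg_mul_linr x : linear (path_alg_mul x).
Proof.
move=> k y y'; rewrite !path_alg_mulE {1 3 5}/path_lift scaler_sumr -big_split.
apply: eq_bigr => p _ /=.
by rewrite path_lift_is_linear scalerDr !scalerA mulrC.
Qed.

Lemma path_alg_mul_path p q :
  path_alg_mul (path_elt p) (path_elt q) = path_mul p q.
Proof. by rewrite path_alg_mulE !path_lift_elt. Qed.

Fact path_alg_mulDl : left_distributive path_alg_mul +%R.
Proof. by move=> x y z; rewrite -[x]scale1r path_alg_mul_linl !scale1r. Qed.

Fact path_alg_mulDr : right_distributive path_alg_mul +%R.
Proof. by move=> x y z; rewrite -[y]scale1r path_alg_mul_linr !scale1r. Qed.

Fact path_alg_mul0l y : path_alg_mul 0 y = 0.
Proof. by apply: (addrI (path_alg_mul 0 y)); rewrite -path_alg_mulDl !addr0. Qed.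

Fact path_alg_mul0r x : path_alg_mul x 0 = 0.
Proof. by apply: (addrI (path_alg_mul x 0)); rewrite -path_alg_mulDr !addr0. Qed.

Fact path_alg_mulA : associative path_alg_mul.
Proof.
move=> x y z; elim/path_alg_ind: x => [k x x' IH IH'||p].
- by rewrite !path_alg_mul_linl IH IH'.
- by rewrite !path_alg_mul0l.
elim/path_alg_ind: y => [k y y' IH IH'||q].
- by rewrite !(path_alg_mul_linl, path_alg_mul_linr) IH IH'.
- by rewrite path_alg_mul0l !path_alg_mul0r path_alg_mul0l.
elim/path_alg_ind: z => [k z z' IH IH'||r].
- by rewrite !path_alg_mul_linr IH IH'.
- by rewrite !path_alg_mul0r.
rewrite !path_alg_mul_path.
have mulo o : path_alg_mul (path_elt p) (oapp path_elt 0 o)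
    = oapp path_elt 0 (obind (path_cat p) o).
  by case: o => [s|] /=; rewrite ?path_alg_mul_path ?path_alg_mul0r.
have omul o : path_alg_mul (oapp path_elt 0 o) (path_elt r)
    = oapp path_elt 0 (obind (@path_cat Q ^~ r) o).
  by case: o => [s|] /=; rewrite ?path_alg_mul_path ?path_alg_mul0l.
by rewrite /path_mul mulo omul path_catA.
Qed.

Lemma path_mul_trivl v p :
  path_mul (trivial_path v) p = (v == path_start p)%:R *: path_elt p.
Proof.
rewrite /path_mul; case: path_catP => [r ep sr _ ar|ne].
  rewrite -[v]/(path_end (trivial_path v)) ep eqxx scale1r /=; congr path_elt.
  by apply: qpath_inj; [rewrite sr -ep | rewrite ar].
by rewrite [_ == _]negbTE ?scale0r //; apply/eqP.
Qed.

Lemma path_mul_trivr v p :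
  path_mul p (trivial_path v) = (v == path_end p)%:R *: path_elt p.
Proof.
rewrite /path_mul; case: path_catP => [r ep sr _ ar|ne].
  rewrite ep -[path_start _]/v eqxx scale1r /=; congr path_elt.
  by apply: qpath_inj => //; rewrite ar cats0.
by rewrite eq_sym [_ == _]negbTE ?scale0r //; apply/eqP.
Qed.

Fact path_alg_mul1l : left_id path_alg_one path_alg_mul.
Proof.
elim/path_alg_ind=> [k x y IH IH'||p]; first by rewrite path_alg_mul_linr IH IH'.
  exact: path_alg_mul0r.
rewrite path_alg_mulE linear_sum (bigD1 (path_start p)) //= big1 => [|v ne].
  by rewrite addr0 !path_lift_elt path_mul_trivl eqxx scale1r.
by rewrite !path_lift_elt path_mul_trivl (negPf ne) scale0r.
Qed.

Fact path_alg_mul1r : right_id path_alg_one path_alg_mul.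
Proof.
elim/path_alg_ind=> [k x y IH IH'||p]; first by rewrite path_alg_mul_linl IH IH'.
  exact: path_alg_mul0l.
rewrite path_alg_mulE path_lift_elt linear_sum (bigD1 (path_end p)) //=.
rewrite big1 => [|v ne].
  by rewrite addr0 !path_lift_elt path_mul_trivr eqxx scale1r.
by rewrite !path_lift_elt path_mul_trivr (negPf ne) scale0r.
Qed.

(* Only a pzRingType, since the quiver may have no vertices; the algType
   structure of MathComp requires 1 != 0. *)
HB.instance Definition _ := GRing.Zmodule_isPzRing.Build path_algebra
  path_alg_mulA path_alg_mul1l path_alg_mul1r path_alg_mulDl path_alg_mulDr.

Lemma path_alg_scalerAl (k : K) (x y : path_algebra) :
  k *: (x * y) = k *: x * y.
Proof.
by rewrite -[in RHS](addr0 (k *: x)) [RHS]path_alg_mul_linl path_alg_mul0l addr0.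
Qed.

Lemma path_alg_scalerAr (k : K) (x y : path_algebra) :
  k *: (x * y) = x * (k *: y).
Proof.
by rewrite -[in RHS](addr0 (k *: y)) [RHS]path_alg_mul_linr path_alg_mul0r addr0.
Qed.

(** Membership in the two-sided ideal generated by the elements of rels. *)
Definition in_ideal (rels : seq path_algebra) (x : path_algebra) : Prop :=
  exists s : seq (path_algebra * path_algebra * path_algebra),
    all (fun t => t.1.2 \in rels) s /\
    x = \sum_(t <- s) t.1.1 * t.1.2 * t.2.

(** A is (isomorphic to) the quotient of the path algebra KQ by the two-sided
    ideal generated by rels. *)
Definition bound_quiver_algebra (rels : seq path_algebra) (A : falgType K) :
    Prop :=
  exists f : {linear path_algebra -> A},
    [/\ monoid_morphism f,
        forall y, exists x, f x = y &
        forall x, f x = 0 <-> in_ideal rels x].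

End PathAlgebra.

(** * The algebras Lambda_1' and Lambda_2' *)

Variant lambda_vertex := v1 | v2.
Variant lambda_arrow := alpha | beta | gamma.

Definition bool_of_vertex v := if v is v1 then true else false.
Definition vertex_of_bool b := if b then v1 else v2.
Fact bool_of_vertexK : cancel bool_of_vertex vertex_of_bool.
Proof. by case. Qed.
HB.instance Definition _ := Finite.copy lambda_vertex (can_type bool_of_vertexK).

Definition code_of_arrow a :=
  match a with alpha => None | beta => Some true | gamma => Some false end.
Definition arrow_of_code c :=
  match c with None => alpha | Some true => beta | Some false => gamma end.
Fact code_of_arrowK : cancel code_of_arrow arrow_of_code.
Proof. by case. Qed.
HB.instance Definition _ := Finite.copy lambda_arrow (can_type code_of_arrowK).

(** alpha : 2 -> 2, beta : 1 -> 2, gamma : 2 -> 1 *)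
Definition lambda_quiver : quiver :=
  Quiver (fun a => if a is beta then v1 else v2)
         (fun a => if a is gamma then v1 else v2).

Section LambdaRelations.
Variable K : fieldType.

Local Notation a := (arrow_elt K (alpha : arrow lambda_quiver)).
Local Notation b := (arrow_elt K (beta : arrow lambda_quiver)).
Local Notation c := (arrow_elt K (gamma : arrow lambda_quiver)).

Definition lambda1_relations : seq (path_algebra K lambda_quiver) :=
  [:: a ^+ 2 - c * b; b * a * c].

Definition lambda2_relations : seq (path_algebra K lambda_quiver) :=
  [:: a ^+ 2 * c; b * a ^+ 2; b * c; a ^+ 3 - c * b].

End LambdaRelations.

(* Main.v *)
From HB Require Import structures.
Require Import Defs.
From mathcomp Require Import all_boot all_order all_algebra all_field.
From mathcomp Require Import finmap.
From mathcomp.multinomials Require Import monalg.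

(* Both algebras have a basis of paths in which the product of two basis
   elements is a basis element or 0.  The low-degree part
   Q_3 -> Q_2 -> Q_1 -> Q_0 -> A of the minimal projective bimodule resolution,
   with Q_n a direct sum of bimodules A e_i (x) e_j A, has integer coefficients
   in this basis, and so does a contracting homotopy of it that is linear on
   the right; hence exactness is a finite identity between integer
   combinations, valid over every field.  Any resolution of the last kernel
   completes it, and cohomology does not depend on the resolution.  As
   Hom(A e_i (x) e_j A, A) = e_i A e_j, the dimensions of HH^0, HH^1 and HH^2
   only depend on the ranks of three explicit integer matrices, whose nonzero
   elementary divisors are all 1, except for a single 3 in degree 1. *)

Set Implicit Arguments.
Unset Strict Implicit.
Unset Printing Implicit Defensive.

Import GRing.Theory.
Local Open Scope ring_scope.

(** * Projective resolutions and their comparison *)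

(** The algebra A is known only as a quotient of KQ, so the relations might a priori collapse the
    listed paths further. Their independence comes from a representation: KQ acts on K^m through the
    intended multiplication table, the relations are checked to act as zero, and the paths have
    independent actions on the trivial paths. Everything else about A is read off this table, which
    involves neither K nor A, so all checks for one algebra form a closed boolean evaluated by
    [vm_compute].

    The divisor 3 comes from the relation expressing gamma beta. For Lambda_2', replacing each alpha
    in turn by alpha^2 sends alpha^3 - gamma beta to 3 alpha^4 and the other relations to 0. For
    Lambda_1', replacing alpha by alpha^2 yields 2 alpha^3 on alpha^2 - gamma beta, replacing beta
    by beta alpha yields - alpha^3, and both yield beta alpha^2 gamma on beta alpha gamma: their
    difference is 3 alpha^3 on the first relation alone. *)

Section Kernel.
Variables (R : nzRingType) (M N : lmodType R) (f : {linear M -> N}).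

Definition ker_pred : {pred M} := fun x => f x == 0.

Fact ker_submod : submod_closed ker_pred.
Proof.
split=> [|a x y]; rewrite !unfold_in ?linear0 // => /eqP fx /eqP fy.
by rewrite linearP fx fy scaler0 addr0.
Qed.
HB.instance Definition _ := GRing.isSubmodClosed.Build R M ker_pred ker_submod.

(** A module type of its own, since each kernel becomes the next module to be covered. *)
Record kernel := Kernel { kernel_val : M; kernel_valP : kernel_val \in ker_pred }.
HB.instance Definition _ := [isSub for kernel_val].
HB.instance Definition _ := [Choice of kernel by <:].
HB.instance Definition _ := [SubChoice_isSubLmodule of kernel by <:].

Lemma kernelP (x : kernel) : f (val x) = 0.
Proof. exact/eqP/(valP x). Qed.

Section Corestriction.
Variables (L : lmodType R) (g : {linear L -> M}).
Hypothesis fg0 : forall x, f (g x) = 0.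

Fact ker_lift_subproof x : g x \in ker_pred.
Proof. exact/eqP. Qed.
Definition ker_lift x : kernel := Kernel (ker_lift_subproof x).
Fact ker_lift_is_linear : linear ker_lift.
Proof. by move=> a x y; apply: val_inj; rewrite /= linearP. Qed.
HB.instance Definition _ :=
  GRing.isLinear.Build R L kernel *:%R ker_lift ker_lift_is_linear.
End Corestriction.
End Kernel.

Section Resolutions.
Variables (K : fieldType) (R : algType K).
Implicit Types (M N L : lmodType R).

(** [projective] lifts only along maps onto the whole target, so [d] and [f] are corestricted to the
    kernel of [e], onto which [d] is surjective. *)
Lemma projective_lift L M N N' (d : {linear M -> N}) (e : {linear N -> N'})
    (f : {linear L -> N}) :
    projective L -> (forall x, e x = 0 -> exists y, d y = x) ->
    (forall x, e (d x) = 0) -> (forall x, e (f x) = 0) ->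
  exists h : {linear L -> M}, forall x, d (h x) = f x.
Proof.
move=> projL ex ed0 ef0.
have [|h hP] := projL _ _ (ker_lift ed0) (ker_lift ef0).
  move=> y; have [x xP] := ex _ (kernelP y).
  by exists x; apply: val_inj.
by exists h => x; have /(congr1 val) := hP x.
Qed.

Section Comparison.
Variable M : lmodType R.
Implicit Types P Q T : projective_resolution M.

Lemma res_dd P n x : res_d P n (res_d P n.+1 x) = 0.
Proof. by apply/res_exact; exists x. Qed.

Lemma res_aug_d P x : res_aug P (res_d P 0 x) = 0.
Proof. by apply/res_exact0; exists x. Qed.

(** Describes one component of a chain map and hides the lower ones behind existentials; a
    comparison in degree n is then built by plain induction, without choosing an infinite family. *)
Fixpoint chain_map P Q n : (P n -> Q n) -> Prop :=
  match n with
  | 0 => fun f => forall x, res_aug Q (f x) = res_aug P x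
  | m.+1 => fun f => exists2 g : {linear P m -> Q m},
      chain_map g & forall x, res_d Q m (f x) = g (res_d P m x)
  end.

Lemma chain_map_next P Q n (g : {linear P n -> Q n}) : chain_map g ->
  exists2 f : {linear P n.+1 -> Q n.+1},
    chain_map f & forall x, res_d Q n (f x) = g (res_d P n x).
Proof.
move=> gP.
suff [f fP] : exists f : {linear P n.+1 -> Q n.+1},
    forall x, res_d Q n (f x) = (g \o res_d P n) x by exists f => //; exists g.
have projP := @res_projective _ _ _ P n.+1.
case: n => [|n] in g gP projP *.
  apply: (projective_lift projP (e := res_aug Q)) => [x||x] /=.
  - by move/res_exact0.
  - exact: res_aug_d.
  - by rewrite gP res_aug_d.
case: gP => g' _ g'P; apply: (projective_lift projP (e := res_d Q n)) => [x||x] /=.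
- by move/res_exact.
- exact: res_dd.
- by rewrite g'P res_dd linear0.
Qed.

Lemma chain_map_ex P Q n : exists f : {linear P n -> Q n}, chain_map f.
Proof.
elim: n => [|n [f /chain_map_next[g]]]; last by exists g.
have [f fP] := @res_projective _ _ _ P 0 _ _ (res_aug Q) (res_aug P) (res_aug_surj Q).
by exists f.
Qed.

Lemma chain_map_id P n : @chain_map P P n idfun.
Proof. by elim: n => [|n IHn] //=; exists idfun. Qed.

Lemma chain_map_comp P Q T n (f : P n -> Q n) (g : Q n -> T n) :
  chain_map f -> chain_map g -> chain_map (g \o f).
Proof.
elim: n f g => [|n IHn] f g /=; first by move=> fP gP x; rewrite gP fP.
move=> [f' f'P fP] [g' g'P gP]; exists (g' \o f'); first exact: IHn.
by move=> x /=; rewrite gP fP.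
Qed.

Definition null_homotopic P Q n : (P n -> Q n) -> Prop :=
  match n with
  | 0 => fun f => exists s : {linear P 0 -> Q 1}, forall x, f x = res_d Q 0 (s x)
  | m.+1 => fun f => exists (s : {linear P m.+1 -> Q m.+2})
      (t : {linear P m -> Q m.+1}),
      forall x, f x = res_d Q m.+1 (s x) + t (res_d P m x)
  end.

Lemma chain_map_homotopic P Q n (f g : {linear P n -> Q n}) :
  chain_map f -> chain_map g -> null_homotopic (f \- g).
Proof.
elim: n f g => [|n IHn] f g /= => [fP gP|[f' f'P fP] [g' g'P gP]].
  have [|||s sP] := @projective_lift _ _ _ _ (res_d Q 0) (res_aug Q) (f \- g)
    (@res_projective _ _ _ P 0).
  - by move=> x /res_exact0.
  - exact: res_aug_d.
  - by move=> x /=; rewrite linearB fP gP subrr.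
  by exists s => x; rewrite sP.
(* In positive degree the previous homotopy reads f' - g' = d s + t d; on the image of the
   differential the second term vanishes, so [s] serves as the new [t]. *)
have [t tP] : exists t : {linear P n -> Q n.+1},
    forall x, f' (res_d P n x) - g' (res_d P n x) = res_d Q n (t (res_d P n x)).
  case: n IHn f g f' g' f'P fP g'P gP => [|n] IHn f g f' g' f'P fP g'P gP.
    by have [s sP] := IHn _ _ f'P g'P; exists s => x; rewrite -sP.
  have [s [t tP]] := IHn _ _ f'P g'P.
  by exists s => x; have /= -> := tP (res_d P n.+1 x); rewrite res_dd linear0 addr0.
(* What remains after subtracting t d is killed by the differential of Q, hence lifts. *)
have [|||s sP] := @projective_lift _ _ _ _ (res_d Q n.+1) (res_d Q n)
    ((f \- g) \- (t \o res_d P n)) (@res_projective _ _ _ P n.+1).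
- by move=> x /res_exact.
- exact: res_dd.
- by move=> x /=; rewrite !linearB /= fP gP tP subrr.
by exists s, t => x /=; rewrite sP /= subrK.
Qed.

Variable N : lmodType R.

Section Coboundaries.
Variables (P : projective_resolution M) (n : nat).
Implicit Types f g : P n -> N.

Lemma eq_coboundary f g : f =1 g -> coboundary f -> coboundary g.
Proof.
case: n f g => [|m] f g fg /=; first by move=> f0 x; rewrite -fg.
by case=> h hP; exists h => x; rewrite -fg.
Qed.

Lemma coboundaryD f g :
  coboundary f -> coboundary g -> coboundary (fun x => f x + g x).
Proof.
case: n f g => [|m] f g /= => [f0 g0 x|[h hP] [k kP]]; first by rewrite f0 g0 addr0.
by exists (h \+ k) => x; rewrite hP kP.
Qed.

Lemma coboundaryN f : coboundary f -> coboundary (fun x => - f x).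
Proof.
case: n f => [|m] f /= => [f0 x|[h hP]]; first by rewrite f0 oppr0.
by exists (\- h) => x; rewrite hP.
Qed.

Fact scale_central_is_linear L (k : K) : linear (fun x : L => k%:A *: x : L).
Proof.
move=> a x y; rewrite scalerDr !scalerA; congr (_ *: _ + _).
by rewrite mulr_algl mulr_algr.
Qed.

Lemma coboundaryZ k f : coboundary f -> coboundary (fun x => k%:A *: f x).
Proof.
case: n f => [|m] f /= => [f0 x|[h hP]]; first by rewrite f0 scaler0.
pose s := GRing.isLinear.Build R N N *:%R _ (@scale_central_is_linear N k).
pose z : {linear N -> N} := HB.pack (fun x : N => k%:A *: x) s.
by exists (z \o h) => x; rewrite hP.
Qed.

Lemma coboundary0 : coboundary (fun _ : P n => 0 : N).
Proof. by case: n => //= m; exists \0. Qed.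

Lemma coboundary_sum (I : Type) (r : seq I) (F : I -> P n -> N) :
  (forall i, coboundary (F i)) -> coboundary (fun x => \sum_(i <- r) F i x).
Proof.
move=> FP; elim: r => [|i r IHr].
  by apply: eq_coboundary coboundary0 => x; rewrite big_nil.
by apply: eq_coboundary (coboundaryD (FP i) IHr) => x; rewrite big_cons.
Qed.

End Coboundaries.

Lemma coboundary_chain_map P Q n (g : {linear Q n -> P n}) (f : P n -> N) :
  chain_map g -> coboundary f -> coboundary (f \o g).
Proof.
case: n g f => [|n] g f /=; first by move=> _ f0 x; exact: f0.
by case=> g' _ gP [h hP]; exists (h \o g') => x; rewrite /= hP gP.
Qed.

Lemma chain_map_cocycle P Q n (g : {linear Q n -> P n}) (f : {linear P n -> N}) :
  chain_map g -> cocycle f -> cocycle (f \o g).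
Proof. by move=> /chain_map_next[g' _ gP] f0 x /=; rewrite -gP f0. Qed.

(** As [g] is homotopic to the identity, f g - f = f d s + f t d. The first term is 0 since f d = 0,
    and the second is the coboundary of f t; in degree 0 only the first occurs. *)
Lemma cocycle_chain_endo P n (g : {linear P n -> P n}) (f : {linear P n -> N}) :
  chain_map g -> cocycle f -> coboundary (fun x => f (g x) - f x).
Proof.
move=> gP f0; have := chain_map_homotopic gP (chain_map_id P n).
case: n g f gP f0 => [|n] g f gP f0 /= [s].
  by move=> sP x; rewrite -linearB sP f0.
case=> t tP; exists (f \o t) => x.
by rewrite -linearB tP linearD f0 add0r.
Qed.

(** Composition with [g] and with [h] are mutually inverse on classes: h g homotopic to the identity
    of Q gives the existence of coefficients, g h homotopic to that of P their uniqueness. *)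
Theorem cohomology_dim_indep P Q n d :
  cohomology_dim N P n d -> cohomology_dim N Q n d.
Proof.
case=> b bP uP; have [[g gP] [h hP]] := (chain_map_ex Q P n, chain_map_ex P Q n).
exists (fun i => b i \o g) => [i|f f0]; first exact: chain_map_cocycle.
have [c [cP cU]] := uP _ (chain_map_cocycle hP f0).
exists c; split.
  have /= := coboundaryD (coboundary_chain_map gP cP)
    (coboundaryN (cocycle_chain_endo (chain_map_comp gP hP) f0)).
  by apply: eq_coboundary => x /=; rewrite opprB addrC addrA addrNK.
move=> c' c'P; apply: cU.
have bgh i : coboundary (fun x => (c' 0 i)%:A *: (b i (g (h x)) - b i x)).
  apply: coboundaryZ.
  exact: (cocycle_chain_endo (g := g \o h) (chain_map_comp hP gP) (bP i)).
have /= := coboundaryD (coboundary_chain_map hP c'P)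
  (coboundary_sum (index_enum _) bgh).
apply: eq_coboundary => x /=; rewrite -addrA; congr (_ + _).
rewrite -!sumrN -big_split; apply: eq_bigr => i _ /=.
by rewrite scalerBr addKr.
Qed.

End Comparison.

Section Extension.
Variables (M P : lmodType R) (e : {linear P -> M}).
Hypotheses (projP : projective P) (e_surj : forall y, exists x, e x = y).
Variable Q : projective_resolution (kernel e).

Definition res_cons_mod n : lmodType R := if n is m.+1 then Q m else P.
Definition res_cons_d n : {linear res_cons_mod n.+1 -> res_cons_mod n} :=
  match n with
  | 0 => (val : kernel e -> P) \o res_aug Q
  | m.+1 => res_d Q m
  end.

Fact res_cons_projective n : projective (res_cons_mod n).
Proof. by case: n => [|n] //; apply: res_projective. Qed.

Fact res_cons_exact0 x : e x = 0 <-> exists y, res_cons_d 0 y = x.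
Proof.
split=> [ex0|[y <-]]; last exact: kernelP.
have /eqP kx := ex0; have [y yP] := res_aug_surj Q (Kernel kx).
by exists y; rewrite /= yP.
Qed.

Fact res_cons_exact n x : res_cons_d n x = 0 <-> exists y, res_cons_d n.+1 y = x.
Proof.
case: n x => [|n] x; last exact: res_exact.
rewrite -res_exact0 /=; split=> [x0|->] //.
exact: (val_inj (x0 : val _ = val (0 : kernel e))).
Qed.

Definition res_cons : projective_resolution M :=
  ProjectiveResolution (res_aug := e : {linear res_cons_mod 0 -> M})
    res_cons_projective e_surj res_cons_exact0 res_cons_exact.

End Extension.

End Resolutions.

(** * Free modules and free resolutions *)

Section FreeModule.
Variables (K : fieldType) (R : algType K).

Definition free_mod (X : choiceType) : lmodType R := {malg R[X]}.

Section Lift.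
Variables (X : choiceType) (M : lmodType R) (F : X -> M).

Definition free_lift (x : free_mod X) : M :=
  \sum_(p <- msupp (x : {malg R[X]})) (x : {malg R[X]})@_p *: F p.

Lemma free_liftEw (D : {fset X}) (x : free_mod X) :
  (msupp (x : {malg R[X]}) `<=` D)%fset ->
  free_lift x = \sum_(p <- D) (x : {malg R[X]})@_p *: F p.
Proof.
move=> sxd; rewrite /free_lift; apply: big_fset_incl => // p _ px.
by rewrite mcoeff_outdom // scale0r.
Qed.

Fact free_lift_is_linear : linear free_lift.
Proof.
move=> k x y.
pose D := (msupp (k *: x + y : {malg R[X]}) `|`
  (msupp (x : {malg R[X]}) `|` msupp (y : {malg R[X]})))%fset.
rewrite (@free_liftEw D x) ?(@free_liftEw D y) ?(@free_liftEw D (k *: x + y)).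
- rewrite scaler_sumr -big_split; apply: eq_bigr => p _ /=.
  by rewrite mcoeffD mcoeffZ scalerDl scalerA.
- exact: fsubsetUl.
- by rewrite /D fsetUA fsubsetUr.
- by rewrite /D fsetUCA fsubsetUl.
Qed.
HB.instance Definition _ :=
  GRing.isLinear.Build R (free_mod X) M *:%R free_lift free_lift_is_linear.

Lemma free_liftU p : free_lift (<< p >> : {malg R[X]}) = F p.
Proof. by rewrite (free_liftEw msuppU_le) big_seq_fset1 mcoeffUU scale1r. Qed.

End Lift.

Lemma free_liftE X (M : lmodType R) (f : {linear free_mod X -> M}) x :
  f x = free_lift (fun p => f (<< p >> : {malg R[X]})) x.
Proof.
rewrite {1}[x]monalgE linear_sum; apply: eq_bigr => p _ /=.
rewrite -linearZ; congr (f _); apply/malgP => q.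
by rewrite [RHS]mcoeffZ !mcoeffU mulr_natr.
Qed.

Lemma free_mod_projective X : projective (free_mod X).
Proof.
move=> M N g f g_surj.
(* Stated with [==] so that [xchoose] can pick the preimages. *)
have ex p : exists x, g x == f (<< p >> : {malg R[X]}).
  by have [x <-] := g_surj (f (<< p >> : {malg R[X]})); exists x.
exists (free_lift (fun p => xchoose (ex p))) => x.
rewrite [RHS]free_liftE linear_sum; apply: eq_bigr => p _ /=.
by rewrite linearZ /= (eqP (xchooseP (ex p))).
Qed.

(** All elements of M serve as generators, so that kernels which are never computed need no chosen
    generating set. *)
Definition free_cover (M : lmodType R) : {linear free_mod M -> M} :=
  free_lift (fun x : M => x).

Lemma free_cover_surj M y : exists x, free_cover M x = y.
Proof. by exists (<< y >> : {malg R[M]}); apply: free_liftU. Qed.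

Section FreeResolution.
Variable M : lmodType R.

Fixpoint syzygy n : lmodType R :=
  if n is m.+1 then kernel (free_cover (syzygy m)) else M.

Definition free_res_d n :
    {linear free_mod (syzygy n.+1) -> free_mod (syzygy n)} :=
  (val : kernel (free_cover (syzygy n)) -> free_mod (syzygy n))
    \o free_cover (syzygy n.+1).

Fact free_res_exact0 n x :
  free_cover (syzygy n) x = 0 <-> exists y, free_res_d n y = x.
Proof.
split=> [x0|[y <-]]; last exact: kernelP.
have /eqP kx := x0; have [y yP] := free_cover_surj (Kernel kx : syzygy n.+1).
by exists y; rewrite /= yP.
Qed.

Fact free_res_exact n x :
  free_res_d n x = 0 <-> exists y, free_res_d n.+1 y = x.
Proof.
rewrite -free_res_exact0 /=; split=> [x0|->] //.
exact: (val_inj (x0 : val _ = val (0 : kernel (free_cover (syzygy n))))).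
Qed.

Definition free_resolution : projective_resolution M :=
  ProjectiveResolution (res_mod := fun n => free_mod (syzygy n))
    (fun n => @free_mod_projective _) (@free_cover_surj M)
    (@free_res_exact0 0) free_res_exact.

End FreeResolution.
End FreeModule.

(** * From matrix ranks to cohomology dimensions *)

Section Rank.
Variables (K : fieldType) (R : algType K) (M N : lmodType R).
Variables (P : projective_resolution M) (n k l j : nat).
Variable phi : 'rV[K]_k -> {linear P n -> N}.
Variables (Z : 'M[K]_(k, l)) (B : 'M[K]_(j, k)).
Hypothesis phi_linear :
  forall a c c' x, phi (a *: c + c') x = a%:A *: phi c x + phi c' x.
Hypothesis phi_surj : forall f : {linear P n -> N}, exists c, phi c =1 f.
Hypothesis cocycleE : forall c, cocycle (phi c) <-> c *m Z = 0.
Hypothesis coboundaryE : forall c, coboundary (phi c) <-> (c <= B)%MS.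

Lemma coboundary_cocycle (f : {linear P n -> N}) : coboundary f -> cocycle f.
Proof.
case: n f => [|m] f /= => [f0 x|[g gP] x]; first exact: f0.
by rewrite gP res_dd linear0.
Qed.

(** Cocycles correspond to [kermx Z], of dimension k - \rank Z, and coboundaries to the row space of
    [B] inside it. A basis of a complement W of [B] in [kermx Z] gives the representing cocycles. *)
Lemma cohomology_dim_rank :
  cohomology_dim N P n (k - \rank Z - \rank B)%N.
Proof.
have sBZ : (B <= kermx Z)%MS.
  apply/row_subP => i.
  exact/sub_kermxP/cocycleE/coboundary_cocycle/coboundaryE/row_sub.
set W := (kermx Z :\: B)%MS.
have dimW : (k - \rank Z - \rank B)%N = \rank W.
  have := mxrank_cap_compl (kermx Z) B.
  by rewrite (capmx_idPr sBZ) mxrank_ker /W => <-; rewrite addKn.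
have WB : (W :&: B = 0)%MS by apply/eqP; rewrite -submx0 capmx_diff.
rewrite dimW; pose w i : 'rV_k := row i (row_base W).
have phi_sum m (c : 'I_m -> K) (v : 'I_m -> 'rV_k) x :
    phi (\sum_i c i *: v i) x = \sum_i (c i)%:A *: phi (v i) x.
  elim/big_rec2: _ => [|i y u _ <-]; last by rewrite phi_linear.
  have := phi_linear (-1) 0 0 x.
  by rewrite scaler0 add0r scaleN1r scaleNr scale1r addNr.
have phiB (c : 'rV_(\rank W)) (u : 'rV_k) x :
    phi u x - \sum_i (c 0 i)%:A *: phi (w i) x = phi (u - c *m row_base W) x.
  rewrite mulmx_sum_row -phi_sum.
  rewrite [RHS](_ : _ = phi (-1 *: (\sum_i c 0 i *: w i) + u) x).
    by rewrite phi_linear scaleN1r scaleNr scale1r addrC.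
  by rewrite scaleN1r addrC.
exists (fun i => phi (w i)) => [i|f f0].
  apply/cocycleE/sub_kermxP; apply: submx_trans (row_sub _ _) _.
  by rewrite eq_row_base diffmxSl.
have [u uf] := phi_surj f.
have uZ : (u <= kermx Z)%MS.
  by apply/sub_kermxP/cocycleE => x; rewrite uf f0.
have /sub_addsmxP[[v v'] /= uE] : (u <= W + B)%MS.
  apply: submx_trans uZ _; rewrite -(addsmx_diff_cap_eq (kermx Z) B).
  by rewrite addsmxS ?capmxSr.
have /submxP[c cE] : (v *m W <= row_base W)%MS by rewrite eq_row_base submxMl.
exists c; split=> [|c' c'P].
  apply: (@eq_coboundary _ _ _ _ P n (phi (u - c *m row_base W))) => [x|].
    by rewrite -phiB uf.
  by apply/coboundaryE; rewrite uE cE addrC addrA addNr add0r submxMl.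
have : (u - c' *m row_base W <= B)%MS.
  apply/coboundaryE; apply: eq_coboundary c'P => x.
  by rewrite -phiB uf.
(* Uniqueness: the combination of the basis of W with coefficients c - c' lies in W and in the row
   space of [B], hence is 0. *)
rewrite uE cE addrAC -mulmxBl => /submxP[y yE].
apply/eqP; rewrite -subr_eq0; apply/eqP.
apply: (row_free_inj (row_base_free W)); rewrite mul0mx; apply/eqP.
rewrite -submx0 -WB sub_capmx; apply/andP; split.
  by rewrite (submx_trans (submxMl _ _)) ?eq_row_base.
by rewrite -[X in (X <= _)%MS](addrK (v' *m B)) yE -mulmxBl submxMl.
Qed.

End Rank.

(** * Direct sums of left ideals generated by idempotents *)

Section IdempotentModule.
Variables (K : fieldType) (R : algType K) (es : seq R).
Local Notation k := (size es).

(** These rows form the direct sum of the left ideals R e_g. Over the enveloping algebra, if e is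
    x_s on the left and x_t on the right, R e is the bimodule A x_s (x) x_t A. *)
Definition idem_pred : {pred 'rV[R]_k} :=
  fun y => [forall g : 'I_k, y 0 g * es`_g == y 0 g].

Fact idem_submod : submod_closed idem_pred.
Proof.
split=> [|a x y]; rewrite !unfold_in.
  by apply/forallP => g; rewrite mxE mul0r.
move=> /forallP xP /forallP yP; apply/forallP => g.
by rewrite !mxE mulrDl -mulrA (eqP (xP g)) (eqP (yP g)).
Qed.
HB.instance Definition _ :=
  GRing.isSubmodClosed.Build R 'rV[R]_k idem_pred idem_submod.

Record idem_mod := IdemMod { idem_val : 'rV[R]_k; _ : idem_val \in idem_pred }.
HB.instance Definition _ := [isSub for idem_val].
HB.instance Definition _ := [Choice of idem_mod by <:].
HB.instance Definition _ := [SubChoice_isSubLmodule of idem_mod by <:].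

(* Total in the index: the generator is 0 when [g] is out of range. *)
Definition idem_gen (g : nat) : idem_mod :=
  insubd 0 (\row_(h < k) if val h == g then es`_g else 0).

Section Lift.
Variables (M : lmodType R) (F : nat -> M).
(** No compatibility is asked of [F]: a generator, whose only nonzero coordinate is e_g, goes to e_g
    F(g). *)
Definition idem_lift (y : idem_mod) : M := \sum_(g < k) val y 0 g *: F g.
Fact idem_lift_is_linear : linear idem_lift.
Proof.
move=> a x y; rewrite /idem_lift scaler_sumr -big_split; apply: eq_bigr => g _.
by rewrite linearP !mxE scalerDl scalerA.
Qed.
HB.instance Definition _ :=
  GRing.isLinear.Build R idem_mod M *:%R idem_lift idem_lift_is_linear.
End Lift.

Hypothesis es_idem : forall e, e \in es -> e * e = e.

Lemma val_idem_gen g :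
  val (idem_gen g) = \row_(h < k) if val h == g then es`_g else 0.
Proof.
rewrite insubdK // unfold_in; apply/forallP => h; rewrite !mxE.
case: (val h =P g) => [<-|_]; last by rewrite mul0r.
exact/eqP/es_idem/mem_nth/ltn_ord.
Qed.

Lemma val_scale_gen a g (h : 'I_k) :
  val (a *: idem_gen g) 0 h = if val h == g then a * es`_g else 0.
Proof.
by rewrite linearZ /= val_idem_gen !mxE; case: ifP => _; rewrite ?mulr0.
Qed.

Lemma idem_modE (y : idem_mod) : y = \sum_(g < k) val y 0 g *: idem_gen g.
Proof.
apply: val_inj; rewrite linear_sum; apply/rowP => h.
rewrite summxE (bigD1 h) // big1 => [|g ne]; last first.
  by rewrite val_scale_gen ifN // eq_sym.
rewrite [RHS]addr0 val_scale_gen eqxx.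
by have := valP y; rewrite unfold_in => /forallP/(_ h)/eqP.
Qed.

Lemma idem_liftE (M : lmodType R) (f : {linear idem_mod -> M}) :
  f =1 idem_lift (fun g => f (idem_gen g)).
Proof.
move=> y; rewrite {1}[y]idem_modE linear_sum; apply: eq_bigr => g _ /=.
by rewrite linearZ.
Qed.

Lemma idem_gen_fix g : es`_g *: idem_gen g = idem_gen g.
Proof.
apply: val_inj; rewrite linearZ /= val_idem_gen; apply/rowP => h; rewrite !mxE.
case: (val h =P g) => [<-|_]; last by rewrite mulr0.
exact/es_idem/mem_nth/ltn_ord.
Qed.

Lemma idem_lift_gen (M : lmodType R) (F : nat -> M) g :
  (g < k)%N -> idem_lift F (idem_gen g) = es`_g *: F g.
Proof.
move=> gk; rewrite /idem_lift (bigD1 (Ordinal gk)) //= big1 => [|h ne].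
  by rewrite val_idem_gen mxE eqxx addr0.
by rewrite val_idem_gen mxE ifN ?scale0r.
Qed.

Lemma idem_gen_out g : (k <= g)%N -> idem_gen g = 0.
Proof.
move=> kg; apply: val_inj; rewrite val_idem_gen; apply/rowP => h; rewrite !mxE.
by rewrite nth_default // if_same.
Qed.

Lemma idem_mod_ext (M : lmodType R) (f f' : {linear idem_mod -> M}) :
  (forall g, (g < k)%N -> f (idem_gen g) = f' (idem_gen g)) -> f =1 f'.
Proof.
move=> ff' y; rewrite (idem_liftE f) (idem_liftE f'); apply: eq_bigr => g _.
by rewrite ff'.
Qed.

Lemma idem_mod_projective : projective idem_mod.
Proof.
move=> M N p f p_surj.
have ex g : exists x, p x == f (idem_gen g).
  by have [x <-] := p_surj (f (idem_gen g)); exists x.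
exists (idem_lift (fun g => xchoose (ex g))).
apply: (idem_mod_ext (f := p \o idem_lift (fun g => xchoose (ex g)))) => g gk /=.
(* The chosen preimage need not be fixed by e_g, but its multiple by e_g lies over e_g f(gen) =
   f(gen). *)
rewrite idem_lift_gen // linearZ /= (eqP (xchooseP (ex g))) -linearZ.
by rewrite idem_gen_fix.
Qed.

End IdempotentModule.

(** * Formal integer combinations *)

Section FormalSums.
Variable T : eqType.
Implicit Type s : seq (int * T).

Definition coef (k : T) s : int :=
  foldr (fun t z => if t.2 == k then t.1 + z else z) 0 s.

Definition vanishes s := all (fun t => coef t.2 s == 0) s.

Definition fscale (c : int) s := [seq (c * t.1, t.2) | t <- s].

Variables (V : zmodType) (v : T -> V).

Definition fsum s : V := \sum_(t <- s) v t.2 *~ t.1.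

Lemma fsum_cons t s : fsum (t :: s) = v t.2 *~ t.1 + fsum s.
Proof. exact: big_cons. Qed.

Lemma fsum_cat s1 s2 : fsum (s1 ++ s2) = fsum s1 + fsum s2.
Proof. exact: big_cat. Qed.

Lemma fsum_scale c s : fsum (fscale c s) = fsum s *~ c.
Proof.
rewrite /fsum big_map mulrz_suml; apply: eq_bigr => t _ /=.
by rewrite mulrC mulrzA.
Qed.

Lemma fsum_coef k s :
  fsum s = v k *~ coef k s + fsum [seq t <- s | t.2 != k].
Proof.
elim: s => [|t s IHs] /=; first by rewrite /fsum big_nil mulr0z addr0.
rewrite fsum_cons IHs; case: eqP => [<-|_] /=; first by rewrite mulrzDr addrA.
by rewrite fsum_cons addrCA.
Qed.

Lemma coef_filter k k' s : k != k' ->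
  coef k [seq t <- s | t.2 != k'] = coef k s.
Proof.
move=> kk'; elim: s => //= t s IHs; case: (eqVneq t.2 k') => [->|_] /=.
  by rewrite eq_sym (negPf kk').
by rewrite IHs.
Qed.

(** Induction on the length: the terms sharing the key of the head cancel, and dropping them changes
    no other coefficient. With integer coefficients, one check covers every field. *)
Lemma fsum_vanishes s : vanishes s -> fsum s = 0.
Proof.
have [n] := ubnP (size s); elim: n s => // n IHn [|t s]; first by rewrite /fsum big_nil.
rewrite ltnS => sn s0; have := allP s0 t (mem_head t s) => /eqP t0.
rewrite (fsum_coef t.2) t0 mulr0z add0r; apply: IHn.
  apply: leq_ltn_trans sn; rewrite /= eqxx /= size_filter.
  exact: count_size.
apply/allP => u; rewrite mem_filter => /andP[ut us].
by rewrite coef_filter //; apply: (allP s0).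
Qed.

End FormalSums.

Section Restriction.
Variables (K : fieldType) (R : algType K) (M : lmodType R).

(** [tensor_lift] takes values in K-spaces, so an R-module is made into one through k |-> [k%:A]. *)
Definition restrict : Type := M.
HB.instance Definition _ := GRing.Zmodule.on restrict.

Definition restrict_scale (k : K) (x : restrict) : restrict := k%:A *: (x : M).

Fact restrict_scaleA a b x :
  restrict_scale a (restrict_scale b x) = restrict_scale (a * b) x.
Proof. by rewrite /restrict_scale scalerA mulr_algl scalerA. Qed.

Fact restrict_scale1 : left_id 1 restrict_scale.
Proof. by move=> x; rewrite /restrict_scale scale1r [LHS]scale1r. Qed.

Fact restrict_scaleDr : right_distributive restrict_scale +%R.
Proof. by move=> a x y; apply: scalerDr. Qed.

Fact restrict_scaleDl x : {morph restrict_scale^~ x : a b / a + b}.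
Proof. by move=> a b; rewrite /restrict_scale !scalerDl. Qed.

HB.instance Definition _ := GRing.Zmodule_isLmodule.Build K restrict
  restrict_scaleA restrict_scale1 restrict_scaleDr restrict_scaleDl.

End Restriction.

(** * Ranks of integer matrices over a field *)

Section IntegerRank.
Variable K : fieldType.

(** A fold rather than a big operator, so that it evaluates under [vm_compute]. *)
Definition sumz n (F : nat -> int) : int :=
  foldr (fun i z => F i + z) 0 (iota 0 n).

Lemma sumzE n F : sumz n F = \sum_(i < n) F i.
Proof.
rewrite -(big_mkord xpredT) /index_iota subn0 /sumz.
by elim: iota => [|i r IHr] /=; rewrite ?big_nil // big_cons IHr.
Qed.

Definition int_mx r c (F : nat -> nat -> int) : 'M[K]_(r, c) :=
  \matrix_(i, j) (F i j)%:~R.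

Definition entry (M : seq (seq int)) i j : int := nth 0 (nth [::] M i) j.

(* Encodes the matrix X diag(d) Y, where X has the left inverse U and Y has the
   right inverse V, so that only the vanishing of the d_i depends on the field. *)
Record rank_cert := RankCert {
  cert_X : seq (seq int); cert_d : seq int; cert_Y : seq (seq int);
  cert_U : seq (seq int); cert_V : seq (seq int)
}.

Variables (k l : nat) (C : rank_cert).
Local Notation r := (size (cert_d C)).

Definition cert_mx i j : int :=
  sumz r (fun h => entry (cert_X C) i h * nth 0 (cert_d C) h * entry (cert_Y C) h j).

Definition cert_ok := all (fun i => all (fun j =>
    (sumz k (fun h => entry (cert_U C) i h * entry (cert_X C) h j) == (i == j)%:Z) &&
    (sumz l (fun h => entry (cert_Y C) i h * entry (cert_V C) h j) == (i == j)%:Z))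
  (iota 0 r)) (iota 0 r).
Hypothesis C_ok : cert_ok.

Lemma rank_diag (ds : seq int) :
  \rank (diag_mx (\row_(i < size ds) (ds`_i)%:~R : 'rV[K]_(size ds))) =
  count (fun d => d%:~R != 0 :> K) ds.
Proof.
elim: ds => [|d ds IHds] /=.
  by apply/eqP; rewrite mxrank_eq0; apply/eqP/matrixP => -[].
pose v : 'rV[K]_1 := d%:~R%:M.
transitivity (\rank (diag_mx (row_mx v (\row_(i < size ds) (ds`_i)%:~R)))).
  congr (\rank (diag_mx _)); apply/rowP => i; rewrite [LHS]mxE.
  case: (@splitP 1 _ i) => j ij; rewrite [RHS]mxE.
    rewrite (_ : i = lshift _ j); last exact: val_inj.
    by rewrite (unsplitK (inl j)) mxE !ord1 eqxx.
  rewrite {1}ij (_ : i = rshift 1 j); last exact: val_inj.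
  by rewrite (unsplitK (inr j)) mxE.
rewrite diag_mx_row rank_diag_block_mx IHds; congr (_ + _)%N.
rewrite (_ : diag_mx v = v); last first.
  by apply/matrixP => i j; rewrite !ord1 !mxE eqxx.
rewrite rank_rV; congr (nat_of_bool (~~ _)); apply/eqP/eqP => [/matrixP/(_ 0 0)|d0].
  by rewrite !mxE eqxx.
by apply/matrixP => i j; rewrite !mxE d0 mul0rn.
Qed.

(** U X = 1 and Y V = 1 hold over the integers, hence over K; so X and Y keep full rank in every
    characteristic and only the diagonal can lose rank. *)
Lemma rank_certP :
  \rank (int_mx k l cert_mx) = count (fun d => d%:~R != 0 :> K) (cert_d C).
Proof.
have ri (i : 'I_r) : val i \in iota 0 r by rewrite mem_iota ltn_ord.
have okP (i j : 'I_r) := allP (allP C_ok _ (ri i)) _ (ri j).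
pose X := int_mx k r (entry (cert_X C)); pose U := int_mx r k (entry (cert_U C)).
pose Y := int_mx r l (entry (cert_Y C)); pose V := int_mx l r (entry (cert_V C)).
have UX : U *m X = 1%:M.
  apply/matrixP => i j; rewrite !mxE [RHS]pmulrn.
  have /andP[/eqP <- _] := okP i j.
  by rewrite sumzE rmorph_sum; apply: eq_bigr => h _; rewrite !mxE -rmorphM.
have YV : Y *m V = 1%:M.
  apply/matrixP => i j; rewrite !mxE [RHS]pmulrn.
  have /andP[_ /eqP <-] := okP i j.
  by rewrite sumzE rmorph_sum; apply: eq_bigr => h _; rewrite !mxE -rmorphM.
have -> : int_mx k l cert_mx =
    X *m (diag_mx (\row_(i < r) ((cert_d C)`_i)%:~R) *m Y).
  apply/matrixP => i j; rewrite !mxE /cert_mx sumzE rmorph_sum; apply: eq_bigr => h _.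
  by rewrite mul_diag_mx !mxE !rmorphM mulrA.
rewrite -rank_diag eqmxMfull; last by apply/row_fullP; exists U.
by rewrite mxrankMfree //; apply/row_freeP; exists V.
Qed.

End IntegerRank.

(** * Bimodules over an algebra with a monomial basis *)

Section Tables.
(* [(c, (i, g, j))] stands for [c] times the element [x_i q_g x_j] of a
   bimodule with generators [q_g], where [x] is a basis of the algebra. *)
Definition term : Type := int * (nat * nat * nat).

(* [x_i x_j = x_k] is encoded by [Some k], and [x_i x_j = 0] by [None]. *)
Variable tab : seq (seq (option nat)).
Definition mulB i j : option nat := nth None (nth [::] tab i) j.

Definition actT i j (t : term) : option term :=
  let: (c, (i', g, j')) := t in
  if mulB i i' is Some a then
    if mulB j' j is Some b then Some (c, (a, g, b)) else None
  else None.
Definition act i j (s : seq term) := pmap (actT i j) s.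

Definition ractT j (t : term) : option term :=
  let: (c, (i', g, j')) := t in
  if mulB j' j is Some b then Some (c, (i', g, b)) else None.
Definition ract j (s : seq term) := pmap (ractT j) s.

Definition subst (D : seq (seq term)) (s : seq term) : seq term :=
  flatten [seq fscale t.1 (act t.2.1.1 t.2.2 (nth [::] D t.2.1.2)) | t <- s].

Definition lookup (H : seq (nat * nat * seq term)) g i : seq term :=
  flatten [seq e.2 | e <- H & e.1 == (g, i)].

(** [H] gives the homotopy only on the x_a q_g. Since q_g = x_s q_g x_t, the element x_i q_g x_j is
    (x_i x_s) q_g (x_t x_j), and right linearity takes the last factor out. *)
Definition hsubst (G : seq (nat * nat)) (H : seq (nat * nat * seq term))
    (s : seq term) : seq term :=
  flatten [seq let: (c, (i, g, j)) := t in
    if (g < size G)%N then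
      let: p := nth (0%N, 0%N) G g in
      if mulB i p.1 is Some a then
        if mulB p.2 j is Some b then fscale c (ract b (lookup H g a)) else [::]
      else [::]
    else [::] | t <- s].

Definition mul3 i k j : option nat :=
  if mulB i k is Some a then mulB a j else None.

(* The image of a formal sum under [q_g |-> x_(n g)]. *)
Definition evalT (n : nat -> option nat) (t : term) : option (int * nat) :=
  let: (c, (i, g, j)) := t in
  if n g is Some k then omap (pair c) (mul3 i k j) else None.

End Tables.

Section Monomial.
Variables (K : fieldType) (A : falgType K) (m : nat) (xs : m.-tuple A).
Hypothesis xs_basis : basis_of {:A} xs.
Variable tab : seq (seq (option nat)).
Local Notation x i := ((xs : seq A)`_i).
Local Notation mulB := (mulB tab).
Hypothesis mulBE : forall i j, x i * x j = oapp (fun a => x a) 0 (mulB i j).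
Hypothesis mulB_lt : forall i j a, mulB i j = Some a -> (a < m)%N.
Local Notation R := (enveloping A).
Local Notation regA := (regular_bimodule A).

Lemma basis_ind (P : A -> Prop) :
    (forall k a b, P a -> P b -> P (k *: a + b)) -> P 0 ->
    (forall i, (i < m)%N -> P (x i)) ->
  forall a, P a.
Proof.
move=> Plin P0 Px a; rewrite (coord_basis xs_basis (memvf a)).
apply: (big_ind P) => // [b c Pb Pc|i _].
  by rewrite -[b]scale1r; apply: Plin.
by rewrite -[_ *: _]addr0; apply: Plin => //; apply: Px.
Qed.

(** The factors are swapped since a (x) b acts by y |-> b y a; thus [xt i j] acts by y |-> x_i y
    x_j. *)
Definition xt i j : R := tens (x j : A^c) (x i).

Lemma tens0l (b : A) : tens (0 : A^c) b = 0 :> R.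
Proof. by apply/matrixP => i j; rewrite !mxE linear0 mul0r. Qed.

Lemma tens0r (a : A^c) : tens a (0 : A) = 0 :> R.
Proof. by apply/matrixP => i j; rewrite !mxE linear0 mulr0. Qed.

Lemma tens_mul (a a' b b' : A) :
  (tens (a : A^c) b : R) * (tens (a' : A^c) b' : R) =
  tens (a' * a : A) (b * b').
Proof. exact: tensor_mul_tens. Qed.

Lemma xt_mul i j i' j' : xt i j * xt i' j' =
  if mulB i i' is Some a then if mulB j' j is Some b then xt a b else 0 else 0.
Proof.
rewrite tens_mul !mulBE.
case: (mulB i i') => [a|]; case: (mulB j' j) => [b|] //=.
all: by rewrite ?tens0l ?tens0r.
Qed.

Section Evaluation.
Variables (M : lmodType R) (q : nat -> M).

Definition eval : seq (term) -> M :=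
  fsum (fun k : nat * nat * nat => xt k.1.1 k.2 *: q k.1.2).

Lemma evalE s : eval s = \sum_(t <- s) (xt t.2.1.1 t.2.2 *: q t.2.1.2) *~ t.1.
Proof. by []. Qed.

Lemma eval_nil : eval [::] = 0. Proof. by rewrite evalE big_nil. Qed.

Lemma eval_act i j s : xt i j *: eval s = eval (act tab i j s).
Proof.
rewrite !evalE scaler_sumr big_pmap; apply: eq_bigr => -[c [[i' g] j']] _ /=.
rewrite -scalerMzr scalerA xt_mul /actT.
by case: (mulB i i') => [a|]; case: (mulB j' j) => [b|] /=; rewrite ?scale0r ?mul0rz.
Qed.

Lemma eval_ract j s : tens (x j : A^c) 1 *: eval s = eval (ract tab j s).
Proof.
rewrite !evalE scaler_sumr big_pmap; apply: eq_bigr => -[c [[i' g] j']] _ /=.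
rewrite -scalerMzr scalerA tens_mul mul1r mulBE /ractT.
by case: (mulB j' j) => [b|] /=; rewrite ?tens0l ?scale0r ?mul0rz.
Qed.

End Evaluation.

Lemma eval_subst (M N : lmodType R) (q : nat -> M) (q' : nat -> N)
    (f : {linear M -> N}) (D : seq (seq term)) s :
    (forall g, f (q g) = eval q' (nth [::] D g)) ->
  f (eval q s) = eval q' (subst tab D s).
Proof.
move=> fq; rewrite evalE linear_sum /subst /eval /fsum big_flatten big_map.
apply: eq_bigr => t _; rewrite raddfMz /= linearZ /= fq eval_act.
exact/esym/fsum_scale.
Qed.

Section Bimodule.
Variable G : seq (nat * nat).
Local Notation lft g := (nth (0%N, 0%N) G g).1.
Local Notation rgt g := (nth (0%N, 0%N) G g).2.

(* The direct sum of the bimodules [A x_s (x) x_t A] for [(s, t)] in [G]. *)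
Definition bimod : lmodType R := idem_mod [seq xt p.1 p.2 | p <- G].
Definition gen g : bimod := idem_gen _ g.

Definition gens_ok := all (fun p =>
  (mulB p.1 p.1 == Some p.1) && (mulB p.2 p.2 == Some p.2)) G.
Hypothesis G_ok : gens_ok.

Lemma gens_idem e : e \in [seq xt p.1 p.2 | p <- G] -> e * e = e.
Proof.
case/mapP => p pG ->; have /andP[/eqP es /eqP et] := allP G_ok _ pG.
by rewrite xt_mul es et.
Qed.

Lemma nth_gens g : (g < size G)%N ->
  [seq xt p.1 p.2 | p <- G]`_g = xt (lft g) (rgt g).
Proof. by move=> gG; rewrite (nth_map (0, 0)%N). Qed.

Lemma gen_fix g : (g < size G)%N -> xt (lft g) (rgt g) *: gen g = gen g.
Proof. by move=> gG; rewrite -nth_gens // idem_gen_fix //; apply: gens_idem. Qed.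

Lemma scale_central (M : lmodType R) (k : K) (X : R) (y : M) :
  (k *: X) *: y = k%:A *: (X *: y).
Proof. by rewrite scalerA mulr_algl. Qed.

(** Reduces an identity between K-linear maps to the finitely many x_i q_g x_j, where it can be
    checked by enumeration. *)
Lemma bimod_ind (P : bimod -> Prop) :
    (forall k y z, P y -> P z -> P (k%:A *: y + z)) -> P 0 ->
    (forall i g j, (i < m)%N -> (g < size G)%N -> (j < m)%N ->
       P (xt i j *: gen g)) ->
  forall y, P y.
Proof.
move=> Plin P0 Pgen y; rewrite (idem_modE gens_idem y).
apply: (big_ind P) => // [u v Pu Pv|g _].
  by rewrite -[u]scale1r -[1]scale1r; apply: Plin.
have gG : (g < size G)%N by rewrite -(size_map (fun p => xt p.1 p.2)).
elim/tensor_ind: (val y 0 g) => [k X Y IHX IHY||a b].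
- by rewrite scalerDl scale_central; apply: Plin.
- by rewrite scale0r.
elim/basis_ind: a => [k a a' IHa IHa'||j jm].
- by rewrite tens_linl scalerDl scale_central; apply: Plin.
- by rewrite tens0l scale0r.
elim/basis_ind: b => [k b b' IHb IHb'||i im].
- by rewrite tens_linr scalerDl scale_central; apply: Plin.
- by rewrite tens0r scale0r.
exact: Pgen.
Qed.

Section Differential.
Variables (N : lmodType R) (q : nat -> N) (D : seq (seq term)).

(** Each D_g must be fixed by x_s on the left and x_t on the right, because [idem_lift] multiplies
    by them. The size condition extends [bimod_d_gen] to indices out of range, where both sides are
    0. *)
Definition diff_ok := (size D == size G) && all (fun g =>
  act tab (lft g) (rgt g) (nth [::] D g) == nth [::] D g) (iota 0 (size G)).

Definition bimod_d : {linear bimod -> N} :=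
  idem_lift (fun g => eval q (nth [::] D g)).

Lemma bimod_d_gen g : diff_ok -> bimod_d (gen g) = eval q (nth [::] D g).
Proof.
move=> /andP[/eqP sD /allP DP]; case: (ltnP g (size G)) => gG.
  rewrite [LHS]idem_lift_gen ?size_map //; last exact: gens_idem.
  by rewrite nth_gens // eval_act (eqP (DP g _)) // mem_iota.
rewrite /gen idem_gen_out ?size_map //; last exact: gens_idem.
by rewrite linear0 nth_default ?sD // eval_nil.
Qed.
End Differential.

Section Homotopy.
Variables (N : lmodType R) (q : nat -> N) (H : seq (nat * nat * seq term)).

Definition hbasis g (b : A) : N :=
  \sum_(i < m) (coord xs i b)%:A *: eval q (lookup H g i).

Lemma hbasis_linear g k b c :
  hbasis g (k *: b + c) = k%:A *: hbasis g b + hbasis g c.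
Proof.
rewrite /hbasis scaler_sumr -big_split; apply: eq_bigr => i _ /=.
by rewrite linearP /= scalerDl scalerDl -scalerA scale_central.
Qed.

Lemma hbasis_x g a : (a < m)%N -> hbasis g (x a) = eval q (lookup H g a).
Proof.
move=> am; have Efree := basis_free xs_basis.
rewrite /hbasis (bigD1 (Ordinal am)) //= big1 => [|i ne].
  by rewrite (coord_free (Ordinal am)) // eqxx scale1r scale1r addr0.
by rewrite (coord_free (Ordinal am)) // eq_sym (negPf ne) !scale0r.
Qed.

Lemma hbasis0 g : hbasis g 0 = 0.
Proof. by rewrite /hbasis big1 // => i _; rewrite linear0 !scale0r. Qed.

(** A homotopy linear only on the right is not determined by its values on generators: [hbasis]
    extends it K-linearly in the left factor, and the right factor acts from outside. *)
Definition hmap (y : bimod) : N :=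
  \sum_(g < _) tensor_lift (V := restrict N)
    (fun (a : A^c) b => (tens a 1 : R) *: hbasis g b) (val y 0 g).

Lemma hmap_linear k y z : hmap (k%:A *: y + z) = k%:A *: hmap y + hmap z.
Proof.
rewrite /hmap scaler_sumr -big_split; apply: eq_bigr => g _.
by rewrite linearP !mxE mulr_algl linearP.
Qed.

Fact hmap_is_zmod_morphism : zmod_morphism hmap.
Proof.
move=> y z; have := hmap_linear (-1) z y.
by rewrite !scaleN1r addrC => ->; rewrite addrC.
Qed.
HB.instance Definition _ :=
  GRing.isZmodMorphism.Build bimod N hmap hmap_is_zmod_morphism.

Lemma hmap_tens g (a b : A) : (g < size G)%N ->
  hmap ((tens (a : A^c) b : R) *: gen g) =
    (tens (x (rgt g) * a : A) 1 : R) *: hbasis g (b * x (lft g)).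
Proof.
move=> gG; have gG' : (g < size [seq xt p.1 p.2 | p <- G])%N by rewrite size_map.
rewrite /hmap (bigD1 (Ordinal gG')) // big1 => [|h ne].
  rewrite [LHS]addr0 val_scale_gen; last exact: gens_idem.
  rewrite eqxx nth_gens // tens_mul tensor_lift_tens // => [c|c] k u v.
    rewrite tens_linl scalerDl scale_central; congr (_ + _); exact: erefl.
  by rewrite hbasis_linear scalerDr scalerA mulr_algr scale_central.
rewrite val_scale_gen; last exact: gens_idem.
by rewrite ifN ?linear0.
Qed.

Lemma hmap_eval s : hmap (eval gen s) = eval q (hsubst tab G H s).
Proof.
rewrite evalE raddf_sum /hsubst /eval /fsum big_flatten big_map.
apply: eq_bigr => -[c [[i g] j]] _ /=; rewrite raddfMz /= -/(eval _ _).
case: ltnP => gG; last first.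
  by rewrite /gen idem_gen_out ?size_map ?scaler0 ?raddf0 ?mul0rz ?big_nil //;
     apply: gens_idem.
rewrite hmap_tens // !mulBE.
case ei: (mulB i _) => [a|] /=; last by rewrite hbasis0 scaler0 mul0rz big_nil.
case: (mulB _ j) => [b|] /=; last by rewrite tens0l scale0r mul0rz big_nil.
rewrite hbasis_x ?(mulB_lt ei) // eval_ract.
exact/esym/fsum_scale.
Qed.

End Homotopy.
End Bimodule.

(** * Exactness from a contracting homotopy *)

Section Exactness.
Variables (G1 G : seq (nat * nat)) (D1 : seq (seq term)).
Variables (H : seq (nat * nat * seq term)).
Hypotheses (G1_ok : gens_ok G1) (G_ok : gens_ok G) (D1_ok : diff_ok G1 D1).
Local Notation unit_term G i g j :=
  (act tab i j [:: (1%:Z, ((nth (0%N, 0%N) G g).1, g, (nth (0%N, 0%N) G g).2))]).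

(* The identity d h u + h' d' u = u for u = x_i q_g x_j, where d is given by
   [D1], h by [H] and h' d' by [h'd]. *)
Definition homotopy_ok (h'd : seq term -> seq term) := all (fun g =>
  all (fun i => all (fun j =>
    let u := unit_term G i g j in
    vanishes (subst tab D1 (hsubst tab G H u) ++ h'd u ++ fscale (-1) u))
  (iota 0 m)) (iota 0 m)) (iota 0 (size G)).

(** By d h + h' e = 1, any y with e y = 0 equals d (h y). The map [h'] stays abstract because it is
    [unit_map] at the augmentation and the previous homotopy afterwards. *)
Lemma homotopy_exact (N : lmodType R) (e : {linear bimod G -> N})
    (h' : N -> bimod G) (h'd : seq term -> seq term) :
    homotopy_ok h'd ->
    (forall k y z, h' (k%:A *: y + z) = k%:A *: h' y + h' z) ->
    (forall s, h' (e (eval (gen G) s)) = eval (gen G) (h'd s)) ->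
  forall y, e y = 0 -> exists z, bimod_d G1 (gen G) D1 z = y :> bimod G.
Proof.
move=> hok h'lin h'dE y ey; exists (hmap (gen G1) H y).
have h'0 : h' 0 = 0.
  have := h'lin 1 0 0; rewrite scaler0 addr0 !scale1r -{1}[h' 0]addr0.
  by move=> /addrI <-.
suff: bimod_d G1 (gen G) D1 (hmap (gen G1) H y) + h' (e y) = y.
  by rewrite ey h'0 addr0.
elim/(bimod_ind G_ok): y {ey} => [k y z IHy IHz||i g j im gG jm].
- rewrite hmap_linear [e _]linearP h'lin linearP -[in RHS]IHy -[in RHS]IHz.
  by rewrite scalerDr addrACA.
- by rewrite raddf0 !linear0 h'0 addr0.
set u := unit_term G i g j.
have -> : xt i j *: gen G g = eval (gen G) u.
  rewrite -eval_act evalE big_seq1 /= mulr1z.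
  by rewrite gen_fix.
rewrite h'dE hmap_eval //; apply/eqP; rewrite -subr_eq0; apply/eqP.
rewrite (eval_subst (q' := gen G) (D := D1)); last by move=> g'; apply: bimod_d_gen.
have /allP/(_ g) := hok; rewrite mem_iota => /(_ gG) /allP/(_ i).
rewrite mem_iota => /(_ im) /allP/(_ j); rewrite mem_iota => /(_ jm).
move=> /(fsum_vanishes (fun k => xt k.1.1 k.2 *: gen G k.1.2)).
by rewrite !fsum_cat fsum_scale mulrN1z addrA.
Qed.

End Exactness.

(** * Homomorphisms into the regular bimodule *)

Section Homs.
Variable G : seq (nat * nat).
Hypothesis G_ok : gens_ok G.

Lemma xt_scale i j (y : regA) : xt i j *: y = x i * (y : A) * x j.
Proof. exact: env_act_tens. Qed.

Lemma central_scale k (y : regA) : (k%:A : R) *: y = k *: (y : A).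
Proof.
rewrite -[k%:A]addr0 -[LHS]/(env_act _ _) env_act_linl -/(env_act 1 y) env_act1.
by rewrite /env_act linear0 addr0.
Qed.

Lemma eval_hom (f : {linear bimod G -> regA}) (n : nat -> option nat) s :
    (forall g, f (gen G g) = oapp (fun k => x k) 0 (n g)) ->
  f (eval (gen G) s) = fsum (fun k => x k) (pmap (evalT tab n) s).
Proof.
move=> fn; rewrite evalE linear_sum /fsum big_pmap.
apply: eq_bigr => -[c [[i g] j]] _ /=; rewrite raddfMz /= linearZ /= fn xt_scale.
rewrite /evalT /mul3; case: (n g) => [k|] /=; last by rewrite mulr0 mul0r mul0rz.
rewrite mulBE; case: (mulB i k) => [a|] /=; last by rewrite mul0r mul0rz.
by rewrite mulBE; case: (mulB a j) => [b|] /=; rewrite ?mul0rz.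
Qed.

(** The pair (g, i) stands for the homomorphism sending q_g to x_i and the other generators to 0,
    which exists when x_i lies in x_s A x_t. *)
Definition hom_basis : seq (nat * nat) :=
  [seq p <- allpairs pair (iota 0 (size G)) (iota 0 m) |
    mul3 tab (nth (0%N, 0%N) G p.1).1 p.2 (nth (0%N, 0%N) G p.1).2 == Some p.2].
Local Notation hb := hom_basis.
Local Notation hbn l := (nth (0%N, 0%N) hb l).

(** The basis of A is adapted to the idempotents: each x_i lies in x_s A x_t or is killed by the
    projection onto it. So the surviving x_i span x_s A x_t, whence [phi_surj]. *)
Definition homs_ok := all (fun g => all (fun i =>
  let: z := mul3 tab (nth (0%N, 0%N) G g).1 i (nth (0%N, 0%N) G g).2 in
  (z == None) || (z == Some i)) (iota 0 m)) (iota 0 (size G)).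
Hypothesis homs_okP : homs_ok.

Lemma hb_uniq : uniq hb.
Proof.
apply/filter_uniq/allpairs_uniq; rewrite ?iota_uniq // => -[? ?] [? ?] _ _ /= E.
by case: E => -> ->.
Qed.

Lemma mem_hb g i : ((g, i) \in hb) =
  [&& mul3 tab (nth (0%N, 0%N) G g).1 i (nth (0%N, 0%N) G g).2 == Some i,
      (g < size G)%N & (i < m)%N].
Proof.
rewrite mem_filter /=; congr (_ && _).
apply/allpairsP/andP => [[[a b] /= [ha hb [-> ->]]]|[ha hb]].
  by move: ha hb; rewrite !mem_iota.
by exists (g, i); rewrite /= !mem_iota.
Qed.

Lemma hb_lt (l : 'I_(size hb)) : ((hbn l).2 < m)%N.
Proof.
have := mem_nth (0, 0)%N (ltn_ord l); rewrite [nth _ _ _]surjective_pairing.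
by rewrite mem_hb => /and3P[].
Qed.

Definition hom_val (c : 'rV[K]_(size hb)) g : regA :=
  \sum_(l < size hb) if (hbn l).1 == g then c 0 l *: x (hbn l).2 else 0.

Definition phi (c : 'rV[K]_(size hb)) : {linear bimod G -> regA} :=
  idem_lift (hom_val c).

Lemma mul3E i k j : x i * x k * x j = oapp (fun a => x a) 0 (mul3 tab i k j).
Proof.
rewrite mulBE /mul3; case: (mulB i k) => [a|] /=; last by rewrite mul0r.
by rewrite mulBE.
Qed.

Lemma phi_gen c g : phi c (gen G g) = hom_val c g.
Proof.
case: (ltnP g (size G)) => gG; last first.
  rewrite /gen idem_gen_out ?size_map //; last exact: gens_idem.
  rewrite linear0 /hom_val big1 // => l _; case: eqP => // lg.
  have := mem_nth (0, 0)%N (ltn_ord l); rewrite [nth _ _ _]surjective_pairing.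
  by rewrite mem_hb lg ltnNge gG andbF.
rewrite [LHS]idem_lift_gen ?size_map //; last exact: gens_idem.
rewrite nth_gens // xt_scale mulr_sumr mulr_suml; apply: eq_bigr => l _.
case: eqP => [lg|_]; last by rewrite mulr0 mul0r.
rewrite -scalerAr -scalerAl mul3E.
have := mem_nth (0, 0)%N (ltn_ord l); rewrite [nth _ _ _]surjective_pairing.
by rewrite mem_hb lg => /andP[/eqP-> _].
Qed.

Lemma phi_linear a c c' y : phi (a *: c + c') y = (a%:A : R) *: phi c y + phi c' y.
Proof.
rewrite /phi /= /idem_lift scaler_sumr -big_split; apply: eq_bigr => g _ /=.
rewrite [(a%:A : R) *: _]scalerA mulr_algl -(mulr_algr a) -scalerA -scalerDr.
congr (_ *: _); rewrite central_scale scaler_sumr -big_split.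
apply: eq_bigr => l _ /=; rewrite !mxE; case: ifP => _; last by rewrite scaler0 addr0.
by rewrite scalerDl scalerA.
Qed.

Lemma coord_hom_val c (l : 'I_(size hb)) (lm : ((hbn l).2 < m)%N) :
  coord xs (Ordinal lm) (hom_val c (hbn l).1) = c 0 l.
Proof.
rewrite linear_sum (bigD1 l) //= big1 => [|l' ne].
  rewrite eqxx linearZ /= (coord_free (Ordinal lm)) ?(basis_free xs_basis) //.
  by rewrite eqxx mulr1 addr0.
case: eqP => [e1|_]; last by rewrite linear0.
rewrite linearZ /= (coord_free (Ordinal (hb_lt l'))) ?(basis_free xs_basis) //.
case: eqP => [[e2]|_]; last by rewrite mulr0.
have /eqP : hbn l' = hbn l by rewrite [LHS]surjective_pairing e1 e2 -surjective_pairing.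
by rewrite nth_uniq ?hb_uniq // => /eqP/val_inj l'l; rewrite l'l eqxx in ne.
Qed.

Lemma phi_inj c c' : phi c =1 phi c' -> c = c'.
Proof.
move=> cc'; apply/rowP => l; rewrite -!(coord_hom_val _ (hb_lt l)).
by rewrite -!phi_gen cc'.
Qed.

Lemma phi0 y : phi 0 y = 0.
Proof.
have := phi_linear (-1) 0 0 y.
by rewrite scaler0 add0r scaleN1r scaleN1r addNr.
Qed.

Lemma phi_surj (f : {linear bimod G -> regA}) : exists c, phi c =1 f.
Proof.
exists (\row_l coord xs (Ordinal (hb_lt l)) (f (gen G (hbn l).1) : A)).
apply: idem_mod_ext => [|g]; first exact: gens_idem.
rewrite size_map => gG; rewrite [LHS]phi_gen.
have := congr1 f (gen_fix G_ok gG); rewrite linearZ /= xt_scale => fE.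
rewrite -[RHS]fE [X in _ * X * _](coord_basis xs_basis (memvf _)).
rewrite mulr_sumr mulr_suml.
(* [insub] makes the coordinate total in the index, so that the sum over [hb] can be spread over all
   pairs. *)
pose F (p : nat * nat) : A :=
  if p.1 == g
  then oapp (fun i : 'I_m => coord xs i (f (gen G p.1) : A)) 0 (insub p.2) *: x p.2
  else 0.
transitivity (\sum_(p <- hb) F p).
  rewrite (big_nth (0, 0)%N) big_mkord; apply: eq_bigr => l _.
  rewrite /F; case: eqP => // _; rewrite mxE.
  by rewrite (insubT (fun i => i < m)%N (hb_lt l)).
rewrite big_filter big_mkcond big_allpairs_dep /=.
rewrite (bigD1_seq g) ?mem_iota ?iota_uniq //= [X in _ + X]big1 ?addr0 => [|h ne].
  rewrite -{1}[m]subn0 -/(index_iota 0 m) big_mkord; apply: eq_bigr => i _.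
  rewrite /F /= eqxx valK /= -scalerAr -scalerAl mul3E.
  have /allP/(_ g) := homs_okP; rewrite mem_iota => /(_ gG)/allP/(_ i).
  rewrite mem_iota => /(_ (ltn_ord i)) /orP[/eqP->|/eqP->]; last by rewrite eqxx.
  by rewrite /= scaler0.
by apply: big1 => i _; rewrite /F /= (negPf ne) if_same.
Qed.

End Homs.

Section HomDifferential.
Variables (G' G : seq (nat * nat)) (D : seq (seq term)).
Hypotheses (G'_ok : gens_ok G') (G_ok : gens_ok G) (D_ok : diff_ok G' D).
Local Notation k := (size (hom_basis G)).
Local Notation k' := (size (hom_basis G')).
Variable Z : nat -> nat -> int.

(** Composing the l-th basis homomorphism with the differential amounts to evaluating each D_g under
    it; subtracting row l of [Z], expanded at g, must leave nothing. *)
Definition hom_diff_ok := all (fun l => all (fun g =>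
  let: p := nth (0%N, 0%N) (hom_basis G) l in
  vanishes (pmap (evalT tab (fun h => if p.1 == h then Some p.2 else None))
                 (nth [::] D g)
   ++ [seq (- Z l l', (nth (0%N, 0%N) (hom_basis G') l').2) | l' <- iota 0 k' &
        (nth (0%N, 0%N) (hom_basis G') l').1 == g]))
  (iota 0 (size G'))) (iota 0 k).
Hypothesis ZP : hom_diff_ok.

Local Notation hom_mx := (int_mx K k k' Z).

Lemma phi_delta_gen (l : 'I_k) g : phi (delta_mx 0 l) (gen G g) =
  (if (nth (0%N, 0%N) (hom_basis G) l).1 == g
   then x (nth (0%N, 0%N) (hom_basis G) l).2 else 0) :> A.
Proof.
rewrite phi_gen // /hom_val (bigD1 l) //= big1 ?addr0 => [|l' ne].
  by rewrite mxE !eqxx scale1r.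
by rewrite mxE eqxx (negPf ne) scale0r if_same.
Qed.

Lemma phi_d c y : phi c (bimod_d G' (gen G) D y) = phi (c *m hom_mx) y.
Proof.
have phi_sum G0 n (a : 'I_n -> K) (v : 'I_n -> 'rV_(size (hom_basis G0))) z :
    phi (\sum_i a i *: v i) z = \sum_i a i *: (phi (v i) z : A).
  elim/big_rec2: _ => [|i u w _ <-]; last by rewrite phi_linear central_scale.
  exact: phi0.
rewrite [c in LHS]row_sum_delta [in RHS]mulmx_sum_row !phi_sum.
apply: eq_bigr => l _; apply: (congr1 (fun v : A => c 0 l *: v)).
move: y; apply: (idem_mod_ext (gens_idem G'_ok)
  (f := phi (delta_mx 0 l) \o bimod_d G' (gen G) D)) => g.
rewrite size_map => gG /=; rewrite -/(gen G' g) bimod_d_gen //.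
have fn := phi_delta_gen l.
rewrite (eval_hom (n := fun h => if (nth (0%N, 0%N) (hom_basis G) l).1 == h
  then Some (nth (0%N, 0%N) (hom_basis G) l).2 else None)); last first.
  by move=> h; rewrite fn; case: ifP.
rewrite phi_gen //; apply/eqP; rewrite -subr_eq0; apply/eqP.
have /allP/(_ l) := ZP; rewrite mem_iota => /(_ (ltn_ord l))/allP/(_ g).
rewrite mem_iota => /(_ gG) /(fsum_vanishes (fun i => x i)).
rewrite fsum_cat => E; rewrite -[RHS]E; congr (_ + _).
have iE : iota 0 k' = index_iota 0 k' by rewrite /index_iota subn0.
rewrite /fsum big_map big_filter big_mkcond iE big_mkord /hom_val -sumrN.
apply: eq_bigr => l' _; rewrite !mxE /=.
by case: ifP => _; rewrite ?oppr0 // mulrNz scaler_int.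
Qed.

End HomDifferential.

(** * Hochschild cohomology from a checked complex *)

Section Complex.
Variables (ids : seq nat) (G1 G2 G3 : seq (nat * nat)).
Variables (D0 D1 D2 : seq (seq term)) (H0 H1 H2 : seq (nat * nat * seq term)).
Local Notation G0 := [seq (v, v) | v <- ids].
Local Notation idn g := (nth 0%N ids g).

Definition aug_index g := if (g < size ids)%N then Some (idn g) else None.

Definition aug_base : seq term := [seq (1%:Z, (idn g, g, idn g)) | g <- iota 0 (size ids)].
Definition unit_subst (s : seq (int * nat)) : seq term :=
  flatten [seq fscale t.1 (ract tab t.2 aug_base) | t <- s].

Definition complex_ok := [&&
  gens_ok G0 && diff_ok G1 D0, gens_ok G1 && diff_ok G2 D1,
  gens_ok G2 && diff_ok G3 D2 & gens_ok G3] && [&&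
  all (fun g => vanishes (pmap (evalT tab aug_index) (nth [::] D0 g))) (iota 0 (size G1)),
  all (fun g => vanishes (subst tab D0 (nth [::] D1 g))) (iota 0 (size G2)) &
  all (fun g => vanishes (subst tab D1 (nth [::] D2 g))) (iota 0 (size G3))].

Definition exact_ok := [&&
  homotopy_ok G0 D0 H0 (fun s => unit_subst (pmap (evalT tab aug_index) s)),
  homotopy_ok G1 D1 H1 (fun s => hsubst tab G0 H0 (subst tab D0 s)) &
  homotopy_ok G2 D2 H2 (fun s => hsubst tab G1 H1 (subst tab D1 s))].

Hypothesis ids_one : 1 = \sum_(v <- ids) x v.
Hypotheses (cx_ok : complex_ok) (ex_ok : exact_ok).

Let G0_ok : gens_ok G0. Proof. by case/andP: cx_ok => /and4P[/andP[]]. Qed.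
Let G1_ok : gens_ok G1. Proof. by case/andP: cx_ok => /and4P[_ /andP[]]. Qed.
Let G2_ok : gens_ok G2. Proof. by case/andP: cx_ok => /and4P[_ _ /andP[]]. Qed.
Let G3_ok : gens_ok G3. Proof. by case/andP: cx_ok => /and4P[]. Qed.
Let D0_ok : diff_ok G1 D0. Proof. by case/andP: cx_ok => /and4P[/andP[]]. Qed.
Let D1_ok : diff_ok G2 D1. Proof. by case/andP: cx_ok => /and4P[_ /andP[]]. Qed.
Let D2_ok : diff_ok G3 D2. Proof. by case/andP: cx_ok => /and4P[_ _ /andP[]]. Qed.

Definition aug : {linear bimod G0 -> regA} := idem_lift (fun g => x (idn g) : regA).
Local Notation d0 := (bimod_d G1 (gen G0) D0).
Local Notation d1 := (bimod_d G2 (gen G1) D1).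
Local Notation d2 := (bimod_d G3 (gen G2) D2).

Lemma ids_idem g : (g < size ids)%N -> mulB (idn g) (idn g) = Some (idn g).
Proof.
move=> gs; have /allP/(_ (idn g, idn g)) := G0_ok.
rewrite map_f ?mem_nth // => /(_ isT) /=; by case/andP => /eqP.
Qed.

Lemma aug_gen g : aug (gen G0 g) = oapp (fun k => x k) 0 (aug_index g).
Proof.
rewrite /aug_index; case: ltnP => gs.
  rewrite [LHS]idem_lift_gen ?size_map //; last exact: gens_idem.
  rewrite nth_gens ?size_map // (nth_map 0%N) //= xt_scale !mulBE ids_idem //=.
  by rewrite mulBE ids_idem.
by rewrite /gen idem_gen_out ?size_map ?linear0 //; apply: gens_idem.
Qed.

(** The first stage A -> Q_0 of the homotopy, y |-> the sum of the q_v y. It splits [aug] because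
    the idempotents x_v add up to 1. *)
Definition unit_map (y : regA) : bimod G0 :=
  \sum_(g < size ids) (tens (y : A^c) 1 : R) *: gen G0 g.

Lemma unit_map_linear k y z : unit_map (k%:A *: y + z) = k%:A *: unit_map y + unit_map z.
Proof.
rewrite /unit_map scaler_sumr -big_split; apply: eq_bigr => g _ /=.
by rewrite central_scale tens_linl scalerDl scale_central.
Qed.

Fact unit_map_is_zmod_morphism : zmod_morphism unit_map.
Proof.
move=> y z; have := unit_map_linear (-1) z y.
by rewrite !scaleN1r addrC => ->; rewrite addrC.
Qed.
HB.instance Definition _ :=
  GRing.isZmodMorphism.Build regA (bimod G0) unit_map unit_map_is_zmod_morphism.

Lemma aug_unit y : aug (unit_map y) = y.
Proof.
rewrite linear_sum -[RHS](mul1r (y : A)) [in RHS]ids_one (big_nth 0%N) big_mkord.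
rewrite mulr_suml.
apply: eq_bigr => g _; rewrite linearZ /= aug_gen /aug_index ltn_ord /=.
by rewrite [LHS]env_act_tens mul1r.
Qed.

Lemma unit_map_eval s : unit_map (fsum (fun i => x i) s) = eval (gen G0) (unit_subst s).
Proof.
rewrite /fsum raddf_sum /unit_subst evalE big_flatten big_map.
apply: eq_bigr => t _; rewrite raddfMz /=.
rewrite -/(fsum (fun k => xt k.1.1 k.2 *: gen G0 k.1.2) _) fsum_scale -/(eval _ _).
rewrite -eval_ract evalE big_map -{1}[size ids]subn0 -/(index_iota 0 _) big_mkord.
rewrite scaler_sumr; congr (_ *~ _); apply: eq_bigr => g _ /=.
have gG : (g < size G0)%N by rewrite size_map.
by rewrite mulr1z -{1}(gen_fix G0_ok gG) (nth_map 0%N).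
Qed.

Lemma aug_d0 y : aug (d0 y) = 0.
Proof.
move: y; apply: (idem_mod_ext (gens_idem G1_ok) (f := aug \o d0) (f' := \0)) => g.
rewrite size_map => gG /=; rewrite -/(gen G1 g) bimod_d_gen // (eval_hom _ aug_gen).
apply: fsum_vanishes; case/andP: cx_ok => _ /and3P[/allP + _ _].
by apply; rewrite mem_iota.
Qed.

Lemma d0_d1 y : d0 (d1 y) = 0.
Proof.
move: y; apply: (idem_mod_ext (gens_idem G2_ok) (f := d0 \o d1) (f' := \0)) => g.
rewrite size_map => gG /=; rewrite -/(gen G2 g) bimod_d_gen //.
rewrite (eval_subst (q' := gen G0) (D := D0)); last by move=> h; apply: bimod_d_gen.
apply: fsum_vanishes; case/andP: cx_ok => _ /and3P[_ /allP + _].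
by apply; rewrite mem_iota.
Qed.

Lemma d1_d2 y : d1 (d2 y) = 0.
Proof.
move: y; apply: (idem_mod_ext (gens_idem G3_ok) (f := d1 \o d2) (f' := \0)) => g.
rewrite size_map => gG /=; rewrite -/(gen G3 g) bimod_d_gen //.
rewrite (eval_subst (q' := gen G1) (D := D1)); last by move=> h; apply: bimod_d_gen.
apply: fsum_vanishes; case/andP: cx_ok => _ /and3P[_ _ /allP +].
by apply; rewrite mem_iota.
Qed.

Lemma aug_exact y : aug y = 0 -> exists z, d0 z = y.
Proof.
case/and3P: ex_ok => h0 _ _; apply: (homotopy_exact G1_ok G0_ok D0_ok h0).
  exact: unit_map_linear.
by move=> s; rewrite (eval_hom _ aug_gen) unit_map_eval.
Qed.

Lemma d0_exact y : d0 y = 0 -> exists z, d1 z = y.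
Proof.
case/and3P: ex_ok => _ h1 _; apply: (homotopy_exact G2_ok G1_ok D1_ok h1).
  exact: (hmap_linear (gen G1) H0).
move=> s; rewrite (eval_subst (q' := gen G0) (D := D0)).
  exact: hmap_eval.
by move=> h; apply: bimod_d_gen.
Qed.

Lemma d1_exact y : d1 y = 0 -> exists z, d2 z = y.
Proof.
case/and3P: ex_ok => _ _ h2; apply: (homotopy_exact G3_ok G2_ok D2_ok h2).
  exact: (hmap_linear (gen G2) H1).
move=> s; rewrite (eval_subst (q' := gen G1) (D := D1)).
  exact: hmap_eval.
by move=> h; apply: bimod_d_gen.
Qed.

Let aug_surj y : exists z, aug z = y.
Proof. by exists (unit_map y); apply: aug_unit. Qed.

Let k0 : {linear bimod G1 -> kernel aug} := ker_lift aug_d0.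
Let k0_surj y : exists z, k0 z = y.
Proof.
by have [z zy] := aug_exact (kernelP y); exists z; apply: val_inj.
Qed.

Let k0_d1 y : k0 (d1 y) = 0.
Proof. by apply: val_inj; apply: d0_d1. Qed.
Let k1 : {linear bimod G2 -> kernel k0} := ker_lift k0_d1.
Let k1_surj y : exists z, k1 z = y.
Proof.
have [z zy] := d0_exact (congr1 val (kernelP y)).
by exists z; apply: val_inj.
Qed.

Let k1_d2 y : k1 (d2 y) = 0.
Proof. by apply: val_inj; apply: d1_d2. Qed.
Let k2 : {linear bimod G3 -> kernel k1} := ker_lift k1_d2.
Let k2_surj y : exists z, k2 z = y.
Proof.
have [z zy] := d1_exact (congr1 val (kernelP y)).
by exists z; apply: val_inj.
Qed.

Let bimod_projective G : gens_ok G -> projective (bimod G).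
Proof. by move=> GP; apply/idem_mod_projective/gens_idem. Qed.

(** As [val] undoes [ker_lift] by conversion, the first three differentials are d0, d1 and d2
    themselves, and [phi_cocycle] and [phi_coboundary] apply directly. *)
Definition bimod_resolution : projective_resolution regA :=
  res_cons (bimod_projective G0_ok) aug_surj
  (res_cons (bimod_projective G1_ok) k0_surj
  (res_cons (bimod_projective G2_ok) k1_surj
  (res_cons (bimod_projective G3_ok) k2_surj (free_resolution _)))).
Local Notation res := bimod_resolution.

Definition certs_ok (C0 C1 C2 : rank_cert) := [&&
  homs_ok G0, homs_ok G1 & homs_ok G2] && [&&
  hom_diff_ok G1 G0 D0 (cert_mx C0), hom_diff_ok G2 G1 D1 (cert_mx C1) &
  hom_diff_ok G3 G2 D2 (cert_mx C2)] && [&&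
  cert_ok (size (hom_basis G0)) (size (hom_basis G1)) C0,
  cert_ok (size (hom_basis G1)) (size (hom_basis G2)) C1 &
  cert_ok (size (hom_basis G2)) (size (hom_basis G3)) C2].

Variables (C0 C1 C2 : rank_cert).
Hypothesis C_ok : certs_ok C0 C1 C2.
Definition cert_rank (C : rank_cert) := count (fun d => d%:~R != 0 :> K) (cert_d C).

Lemma phi_cocycle (G G' : seq (nat * nat)) D Z (c : 'rV[K]_(size (hom_basis G))) :
    gens_ok G -> gens_ok G' -> diff_ok G' D -> hom_diff_ok G' G D Z ->
  (forall y : bimod G', phi c (bimod_d G' (gen G) D y) = 0) <->
  c *m int_mx K _ (size (hom_basis G')) Z = 0.
Proof.
move=> GP GP' DP ZP; split=> [cd|cZ y]; last by rewrite (phi_d GP' GP DP ZP) cZ phi0.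
by apply: (phi_inj GP') => y; rewrite -(phi_d GP' GP DP ZP) cd phi0.
Qed.

Lemma phi_coboundary (G G' : seq (nat * nat)) D Z (c : 'rV[K]_(size (hom_basis G'))) :
    gens_ok G -> gens_ok G' -> homs_ok G -> diff_ok G' D -> hom_diff_ok G' G D Z ->
  (exists h : {linear bimod G -> regA},
     forall y : bimod G', phi c y = h (bimod_d G' (gen G) D y)) <->
  (c <= int_mx K (size (hom_basis G)) (size (hom_basis G')) Z)%MS.
Proof.
move=> GP GP' HP DP ZP; split=> [[h hP]|/submxP[b ->]].
  have [b bP] := phi_surj GP HP h; apply/submxP; exists b.
  by apply: (phi_inj GP') => y; rewrite -(phi_d GP' GP DP ZP) bP.
by exists (phi b) => y; rewrite (phi_d GP' GP DP ZP).
Qed.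

Let H_ok : [/\ homs_ok G0, homs_ok G1 & homs_ok G2].
Proof. by case/andP: C_ok => /andP[/and3P[]]. Qed.
Let Z_ok : [/\ hom_diff_ok G1 G0 D0 (cert_mx C0), hom_diff_ok G2 G1 D1 (cert_mx C1) &
  hom_diff_ok G3 G2 D2 (cert_mx C2)].
Proof. by case/andP: C_ok => /andP[_ /and3P[]]. Qed.
Let R_ok : [/\ cert_ok (size (hom_basis G0)) (size (hom_basis G1)) C0,
  cert_ok (size (hom_basis G1)) (size (hom_basis G2)) C1 &
  cert_ok (size (hom_basis G2)) (size (hom_basis G3)) C2].
Proof. by case/andP: C_ok => _ /and3P[]. Qed.

Lemma HH_dim_res n d : cohomology_dim regA res n d -> HH_dim A n d.
Proof.
move=> dP; split=> [|P]; first exact: (inhabits res).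
exact: cohomology_dim_indep dP.
Qed.

Lemma HH_dim0 : HH_dim A 0 (size (hom_basis G0) - cert_rank C0).
Proof.
apply: HH_dim_res; case: H_ok Z_ok R_ok => [h0 _ _] [z0 _ _] [r0 _ _].
(* There are no nonzero coboundaries in degree 0, so [B] is the zero matrix. *)
rewrite /cert_rank -(rank_certP K r0) -[X in cohomology_dim _ _ _ X]subn0 
  -[X in cohomology_dim _ _ _ (_ - X)%N]
    (mxrank0 K (size (hom_basis G0)) (size (hom_basis G0))).
apply: (@cohomology_dim_rank K R regA regA res 0 _ _ _ (@phi G0)
  (int_mx K _ _ (cert_mx C0)) 0).
- exact: phi_linear.
- exact: phi_surj.
- by move=> c; apply: phi_cocycle.
move=> c; rewrite submx0; split=> [c0|/eqP-> y]; last exact: phi0.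
by apply/eqP/(phi_inj G0_ok) => y; rewrite phi0; exact: c0.
Qed.

Lemma HH_dim1 : HH_dim A 1 (size (hom_basis G1) - cert_rank C1 - cert_rank C0).
Proof.
apply: HH_dim_res; case: H_ok Z_ok R_ok => [h0 h1 _] [z0 z1 _] [r0 r1 _].
rewrite /cert_rank -(rank_certP K r0) -(rank_certP K r1).
apply: (@cohomology_dim_rank K R regA regA res 1 _ _ _ (@phi G1)
  (int_mx K _ _ (cert_mx C1)) (int_mx K _ _ (cert_mx C0))).
- exact: phi_linear.
- exact: phi_surj.
- by move=> c; apply: phi_cocycle.
by move=> c; apply: phi_coboundary.
Qed.

Lemma HH_dim2 : HH_dim A 2 (size (hom_basis G2) - cert_rank C2 - cert_rank C1).
Proof.
apply: HH_dim_res; case: H_ok Z_ok R_ok => [_ h1 h2] [_ z1 z2] [_ r1 r2].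
rewrite /cert_rank -(rank_certP K r1) -(rank_certP K r2).
apply: (@cohomology_dim_rank K R regA regA res 2 _ _ _ (@phi G2)
  (int_mx K _ _ (cert_mx C2)) (int_mx K _ _ (cert_mx C1))).
- exact: phi_linear.
- exact: phi_surj.
- by move=> c; apply: phi_cocycle.
by move=> c; apply: phi_coboundary.
Qed.

End Complex.

(* The complex Q_3 -> Q_2 -> Q_1 -> Q_0: [cx_ids] lists the idempotents x_v with
   Q_0 = sum of the A x_v (x) x_v A, [cx_diff n] gives Q_(n+1) -> Q_n on the
   generators, and the entry [(g, i, s)] of [cx_homotopy n] says that the
   homotopy Q_n -> Q_(n+1) sends x_i q_g to s (missing entries are 0). *)
Record bimod_complex := BimodComplex {
  cx_ids : seq nat;
  cx_gens1 : seq (nat * nat);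
  cx_gens2 : seq (nat * nat);
  cx_gens3 : seq (nat * nat);
  cx_diff0 : seq (seq term);
  cx_diff1 : seq (seq term);
  cx_diff2 : seq (seq term);
  cx_homotopy0 : seq (nat * nat * seq term);
  cx_homotopy1 : seq (nat * nat * seq term);
  cx_homotopy2 : seq (nat * nat * seq term);
  cx_rank0 : rank_cert; cx_rank1 : rank_cert; cx_rank2 : rank_cert
}.
Variable X : bimod_complex.

Definition bimod_complex_ok := [&&
  complex_ok (cx_ids X) (cx_gens1 X) (cx_gens2 X) (cx_gens3 X)
    (cx_diff0 X) (cx_diff1 X) (cx_diff2 X),
  exact_ok (cx_ids X) (cx_gens1 X) (cx_gens2 X) (cx_diff0 X) (cx_diff1 X) (cx_diff2 X)
    (cx_homotopy0 X) (cx_homotopy1 X) (cx_homotopy2 X) &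
  certs_ok (cx_ids X) (cx_gens1 X) (cx_gens2 X) (cx_gens3 X)
    (cx_diff0 X) (cx_diff1 X) (cx_diff2 X) (cx_rank0 X) (cx_rank1 X) (cx_rank2 X)].

Definition cochain_dims := (size (hom_basis [seq (v, v) | v <- cx_ids X]),
  size (hom_basis (cx_gens1 X)), size (hom_basis (cx_gens2 X))).

Theorem HH_dim_complex k0 k1 k2 :
    1 = \sum_(v <- cx_ids X) x v -> bimod_complex_ok ->
    cochain_dims = (k0, k1, k2) ->
  let r0 := cert_rank (cx_rank0 X) in let r1 := cert_rank (cx_rank1 X) in
  let r2 := cert_rank (cx_rank2 X) in
  [/\ HH_dim A 0 (k0 - r0), HH_dim A 1 (k1 - r1 - r0) & HH_dim A 2 (k2 - r2 - r1)].
Proof.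
rewrite /cochain_dims => one /and3P[cx ex ce] [<- <- <-]; split.
- exact: (HH_dim0 one cx ex ce).
- exact: (HH_dim1 one cx ex ce).
- exact: (HH_dim2 one cx ex ce).
Qed.

End Monomial.

(** * Path algebras with a monomial basis of paths *)

Section PathProducts.
Variables (K : fieldType) (Q : quiver).
Local Notation elt := (@path_elt K Q).

Lemma path_elt_mul (p q : qpath Q) : elt p * elt q = path_mul K p q.
Proof. exact: path_alg_mul_path. Qed.

Lemma path_elt_mul0 (p q : qpath Q) :
  path_end p != path_start q -> elt p * elt q = 0.
Proof. by rewrite path_elt_mul /path_mul; case: path_catP => [r -> |//]; rewrite eqxx. Qed.

Lemma path_elt_cat (p q r : qpath Q) : path_end p = path_start q ->
    path_start r = path_start p -> path_arrows r = path_arrows p ++ path_arrows q ->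
  elt p * elt q = elt r.
Proof.
move=> epq sr ar; rewrite path_elt_mul /path_mul; case: path_catP => // u _ su _ au.
by congr (elt _); apply: qpath_inj; rewrite ?su ?au.
Qed.

Lemma path_elt_trivial p v : elt p * elt (trivial_path v) =
  if path_end p == v then elt p else 0.
Proof.
case: eqP => [ev|/eqP nev]; last exact: path_elt_mul0.
by apply: path_elt_cat => //; rewrite cats0.
Qed.

Lemma path_elt_prod p :
  elt p = elt (trivial_path (path_start p)) * \prod_(a <- path_arrows p) arrow_elt K a.
Proof.
case: p => -[v w] /=; rewrite /path_start /path_arrows /=.
elim: w v => [|a w IHw] v pw.
  by rewrite big_nil mulr1; congr (elt _); apply: qpath_inj.
have /andP[/eqP sa pw'] := pw.
rewrite big_cons mulrA (path_elt_cat (r := arrow_path a)) //.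
have /= := IHw (target a) pw'.
set q : qpath Q := exist _ _ _ => qE.
rewrite -(path_elt_cat (p := arrow_path a) (q := q)) // qE mulrA; congr (_ * _).
by rewrite path_elt_trivial eqxx.
Qed.

Lemma path_elt_arrows p : path_arrows p != [::] ->
  elt p = \prod_(a <- path_arrows p) arrow_elt K a.
Proof.
rewrite path_elt_prod; case: p => -[v [|a w]] //= pw _.
have /andP[/eqP sa _] := pw; rewrite big_cons mulrA.
by rewrite (path_elt_cat (r := arrow_path a)).
Qed.

Lemma in_ideal_rel (rels : seq (path_algebra K Q)) y :
  y \in rels -> in_ideal rels y.
Proof.
move=> yr; exists [:: (1, y, 1)]; rewrite all_seq1 big_seq1.
by split; [exact: yr | rewrite mul1r mulr1].
Qed.

End PathProducts.

(** * A basis of paths certified by a representation *)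

Section MonomialPresentation.
Variables (K : fieldType) (Q : quiver) (w0 : qpath Q) (ws : seq (qpath Q)).
Local Notation m := (size ws).
Local Notation elt := (@path_elt K Q).
Local Notation w i := (nth w0 ws i).

(* [step i a] is the index of the basis path equal to [w_i a], if nonzero. *)
Variable step : nat -> arrow Q -> option nat.
Variable iv : vertex Q -> nat.
Variable rels : seq (qpath Q * option (qpath Q)).

(** A partial automaton on basis paths: reading an arrow multiplies by it on the right, and [None]
    is the product 0. *)
Fixpoint run i (u : seq (arrow Q)) : option nat :=
  if u is a :: u' then if step i a is Some j then run j u' else None else Some i.

Definition mul_table : seq (seq (option nat)) :=
  [seq [seq if path_end (w i) == path_start (w j) then run i (path_arrows (w j))
            else None | j <- iota 0 m] | i <- iota 0 m].

Definition rel_elt (r : qpath Q * option (qpath Q)) : path_algebra K Q :=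
  elt r.1 - oapp elt 0 r.2.

Definition runs_ok :=
  all (fun i => run (iv (path_start (w i))) (path_arrows (w i)) == Some i) (iota 0 m).

(** A pair (p, Some q) is the relation p - q, and (p, None) the relation p. Both sides must act
    alike on every basis path, so that [rho] kills the ideal. *)
Definition rels_ok := all (fun r =>
  (if r.2 is Some q then path_start q == path_start r.1 else true) &&
  all (fun i => (path_end (w i) == path_start r.1) ==>
    (run i (path_arrows r.1) ==
     if r.2 is Some q then run i (path_arrows q) else None)) (iota 0 m)) rels.

Hypothesis iv_ok : forall v, (iv v < m)%N && (w (iv v) == trivial_path v).
Hypothesis step_okb : forall a, all (fun i => if step i a is Some j then
  [&& (j < m)%N, path_end (w i) == source a & path_end (w j) == target a]
  else true) (iota 0 m).
Hypotheses (run_ok : runs_ok) (rel_ok : rels_ok).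

Lemma iv_lt v : (iv v < m)%N.
Proof. by case/andP: (iv_ok v). Qed.

Lemma w_iv v : w (iv v) = trivial_path v.
Proof. by case/andP: (iv_ok v) => _ /eqP. Qed.

Lemma step_ok i a j : (i < m)%N -> step i a = Some j ->
  [/\ (j < m)%N, path_end (w i) = source a & path_end (w j) = target a].
Proof.
move=> im sij; have /allP/(_ i) := step_okb a; rewrite mem_iota sij.
by case/(_ im)/and3P => ? /eqP ? /eqP.
Qed.

Lemma run_w i : (i < m)%N ->
  run (iv (path_start (w i))) (path_arrows (w i)) = Some i.
Proof. by move=> im; apply/eqP/(allP run_ok); rewrite mem_iota. Qed.

Lemma run_end i u j : (i < m)%N -> run i u = Some j ->
  (j < m)%N /\ path_end (w j) = last (path_end (w i)) (map (@target Q) u).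
Proof.
elim: u i => [|a u IHu] i im /=; first by case=> <-.
case sij: (step i a) => [k|] // rk; have [km _ <-] := step_ok im sij.
exact: IHu.
Qed.

Lemma run_cat i u v : run i (u ++ v) = obind (run^~ v) (run i u).
Proof. by elim: u i => //= a u IHu i; case: step. Qed.

Lemma mul_tableE i j : mulB mul_table i j =
  if [&& (i < m)%N, (j < m)%N & path_end (w i) == path_start (w j)]
  then run i (path_arrows (w j)) else None.
Proof.
rewrite /mulB /mul_table; case: (ltnP i m) => im; last first.
  by rewrite (nth_default [::]) ?nth_nil // size_map size_iota.
rewrite (nth_map 0%N) ?size_iota // nth_iota //.
case: (ltnP j m) => jm /=; last by rewrite nth_default // size_map size_iota.
by rewrite (nth_map 0%N) ?size_iota // nth_iota.
Qed.

Lemma mul_table_lt i j a : mulB mul_table i j = Some a -> (a < m)%N.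
Proof.
by rewrite mul_tableE; case: ifP => // /and3P[im _ _] /(run_end im)[].
Qed.

(* The action of paths by right multiplication on the span of the [w_i]. *)
Definition path_mx (p : qpath Q) : 'M[K]_m :=
  \matrix_(i, j) ((path_end (w i) == path_start p) &&
                  (run i (path_arrows p) == Some (val j)))%:R.
Definition rho : path_algebra K Q -> 'M[K]_m := path_lift path_mx.
HB.instance Definition _ := GRing.Linear.on rho.

Lemma rho_elt p : rho (elt p) = path_mx p.
Proof. exact: path_lift_elt. Qed.

Lemma rho_mul y z : rho (y * z) = rho y *m rho z.
Proof.
elim/path_alg_ind: y => [k y y' IH IH'||p].
- by rewrite mulrDl -path_alg_scalerAl !linearP /= IH IH' mulmxDl -scalemxAl.
- by rewrite mul0r !linear0 mul0mx.
elim/path_alg_ind: z => [k z z' IH IH'||q].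
- by rewrite mulrDr -path_alg_scalerAr !linearP /= IH IH'.
- by rewrite mulr0 !linear0.
apply/matrixP => i j; rewrite path_elt_mul /path_mul mxE !rho_elt.
case: path_catP => [r epq sr er ar|npq] /=.
  rewrite rho_elt mxE sr ar run_cat; case: eqP => [ei|ne] /=; last first.
    by rewrite big1 // => k _; rewrite !mxE; case: eqP => // _; rewrite mul0r.
  case ri: (run i _) => [k|] /=; last first.
    by rewrite big1 // => l _; rewrite !mxE ri andbF mul0r.
  have [km ek] := run_end (ltn_ord i) ri.
  rewrite (bigD1 (Ordinal km)) //= big1 => [|l ne].
    by rewrite !mxE ri ei !eqxx mul1r addr0 ek ei -epq eqxx.
  rewrite !mxE ri (_ : (Some k == Some (val l)) = false) ?andbF ?mul0r //.
  by apply: contraNF ne => /eqP[kl]; apply/eqP/val_inj.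
rewrite linear0 mxE big1 // => k _; rewrite !mxE; case: eqP => [ei|]; rewrite ?mul0r //.
case: eqP => [ri|]; rewrite ?mul0r //; have [_ ek] := run_end (ltn_ord i) ri.
by case: eqP => [sk|]; rewrite ?mulr0 //; case: npq; rewrite -sk ek ei.
Qed.

Lemma rho_rel r : r \in rels -> rho (rel_elt r) = 0.
Proof.
move=> rr; have /andP[sr /allP rP] := allP rel_ok r rr.
rewrite linearB /= rho_elt; apply/matrixP => i j; rewrite !mxE.
have := rP i; rewrite mem_iota => /(_ (ltn_ord i)).
case: r.2 sr => [q /eqP sq|_] /=; rewrite ?rho_elt ?linear0 !mxE ?sq.
  by case: eqP => [_ /= /eqP->|_ _] /=; rewrite subrr.
by case: eqP => [_ /= /eqP->|_ _] /=; rewrite subr0.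
Qed.

Lemma rho_ideal y : in_ideal [seq rel_elt r | r <- rels] y -> rho y = 0.
Proof.
case=> s [/allP sP ->]; rewrite linear_sum big_seq big1 // => t ts.
by have /mapP[r rr tr] := sP t ts; rewrite /= !rho_mul tr rho_rel // mulmx0 mul0mx.
Qed.

(** Look at the row of the trivial path at the start of w_i: by [run_ok], w_j contributes the j-th
    unit vector if it starts there and 0 otherwise. So entry i of this row is c_i. *)
Lemma rho_free (c : 'I_m -> K) :
  rho (\sum_i c i *: elt (w i)) = 0 -> forall i, c i = 0.
Proof.
move=> c0 i; pose s := Ordinal (iv_lt (path_start (w i))).
have /matrixP/(_ s i) := c0; rewrite linear_sum summxE (bigD1 i) //= big1 => [|j ne].
  by rewrite linearZ /= rho_elt !mxE w_iv eqxx run_w // eqxx mulr1 addr0.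
rewrite linearZ /= rho_elt !mxE w_iv; case: eqP => [sij|]; rewrite ?mulr0 //.
have := run_w (ltn_ord j); rewrite -sij => ->.
by case: eqP => [[ji]|]; rewrite ?mulr0 //; case/eqP: ne; apply: val_inj.
Qed.

Section Quotient.
Variables (A : falgType K) (f : {linear path_algebra K Q -> A}).
Hypothesis fM : forall y z, f (y * z) = f y * f z.
Hypothesis f1 : f 1 = 1.
Hypothesis f_surj : forall y, exists z, f z = y.
Hypothesis f_ker : forall y, f y = 0 <-> in_ideal [seq rel_elt r | r <- rels] y.

Definition basis_tuple : m.-tuple A :=
  map_tuple (fun p => f (elt p)) (in_tuple ws).
Local Notation x i := ((basis_tuple : seq A)`_i).

Lemma basis_nth i : (i < m)%N -> x i = f (elt (w i)).
Proof. exact: nth_map. Qed.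

Lemma basis_out i : (m <= i)%N -> x i = 0.
Proof. by move=> mi; rewrite nth_default // size_tuple. Qed.

Hypothesis stepE : forall i a, (i < m)%N ->
  x i * f (arrow_elt K a) = oapp (fun j => x j) 0 (step i a).

Lemma run_mul i u : (i < m)%N ->
  x i * \prod_(a <- u) f (arrow_elt K a) = oapp (fun j => x j) 0 (run i u).
Proof.
elim: u i => [|a u IHu] i im /=; first by rewrite big_nil mulr1.
rewrite big_cons mulrA stepE //; case sij: (step i a) => [j|] /=; last by rewrite mul0r.
by apply: IHu; have [] := step_ok im sij.
Qed.

Lemma f_elt p : f (elt p) = f (elt (trivial_path (path_start p))) *
  \prod_(a <- path_arrows p) f (arrow_elt K a).
Proof.
rewrite {1}path_elt_prod fM; congr (_ * _).
by elim: (path_arrows p) => [|a u IHu]; rewrite ?big_nil // !big_cons fM IHu.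
Qed.

Lemma basis_mul i j : x i * x j = oapp (fun k => x k) 0 (mulB mul_table i j).
Proof.
rewrite mul_tableE; case: (ltnP i m) => im; last by rewrite basis_out ?mul0r.
case: (ltnP j m) => jm /=; last by rewrite (basis_out jm) mulr0.
rewrite (basis_nth jm) f_elt mulrA {1}basis_nth // -fM path_elt_trivial.
case: eqP => [_|_] /=; last by rewrite linear0 mul0r.
by rewrite -basis_nth // run_mul.
Qed.

(** Independence: a combination killed by [f] lies in the ideal, hence is killed by [rho]. Spanning:
    a path is a trivial path times arrows, and [stepE] keeps such products in the list up to 0. *)
Lemma basis_tupleP : basis_of {:A} basis_tuple.
Proof.
have x_span i : x i \in <<basis_tuple>>%VS.
  case: (ltnP i m) => im; last by rewrite basis_out ?mem0v.
  by apply/memv_span/mem_nth; rewrite size_tuple.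
rewrite /basis_of; apply/andP; split; last first.
  apply/freeP => k k0 i; apply: rho_free i.
  apply/rho_ideal/f_ker; rewrite linear_sum -[RHS]k0; apply: eq_bigr => i _.
  by rewrite linearZ /= basis_nth.
rewrite eqEsubv subvf; apply/subvP => y _; have [z <-] := f_surj y.
elim/path_alg_ind: z => [k z z' IH IH'||p]; first by rewrite linearP rpredD ?rpredZ.
  by rewrite linear0 mem0v.
rewrite f_elt -w_iv -basis_nth ?iv_lt // run_mul ?iv_lt //.
by case: run => [j|] /=; rewrite ?mem0v.
Qed.

Lemma basis_one : 1 = \sum_(v : vertex Q) x (iv v).
Proof.
rewrite -f1 linear_sum; apply: eq_bigr => v _.
by rewrite basis_nth ?iv_lt // w_iv.
Qed.

End Quotient.
End MonomialPresentation.

(** * The algebras Lambda_1' and Lambda_2' *)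

(* The entry of index i of [t] lists the values of w_i alpha, w_i beta, w_i gamma. *)
Definition step_of (t : seq (option nat * option nat * option nat)) i
    (a : arrow lambda_quiver) : option nat :=
  let: (j, k, l) := nth (None, None, None) t i in
  match (a : lambda_arrow) with alpha => j | beta => k | gamma => l end.

Definition lambda_iv (v : vertex lambda_quiver) : nat :=
  if (v : lambda_vertex) is v1 then 0%N else 1%N.

Local Notation qp v w :=
  (exist (fun p : vertex lambda_quiver * seq (arrow lambda_quiver) =>
     is_path p.1 p.2) (v : lambda_vertex, w : seq lambda_arrow) isT
   : qpath lambda_quiver).

(** Positions in this list are the numerals of the tables below. Of equal paths only one is listed:
    gamma beta appears as alpha^2, and beta gamma beta as beta alpha^2. *)
Definition lambda1_words : seq (qpath lambda_quiver) :=
  [:: qp v1 [::]; qp v2 [::]; qp v1 [:: beta]; qp v2 [:: gamma];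
  qp v2 [:: alpha]; qp v1 [:: beta; alpha]; qp v2 [:: alpha; gamma];
  qp v2 [:: alpha; alpha]; qp v1 [:: beta; gamma];
  qp v1 [:: beta; alpha; alpha]; qp v2 [:: alpha; alpha; gamma];
  qp v2 [:: alpha; alpha; alpha]; qp v1 [:: beta; alpha; alpha; gamma];
  qp v2 [:: alpha; alpha; alpha; alpha]].

Definition lambda1_step : seq (option nat * option nat * option nat) :=
  ([:: (None, Some 2, None); (Some 4, None, Some 3); (Some 5, None, Some 8);
  (None, Some 7, None); (Some 7, None, Some 6); (Some 9, None, None);
  (None, Some 11, None); (Some 11, None, Some 10); (None, Some 9, None);
  (None, None, Some 12); (None, Some 13, None); (Some 13, None, None);
  (None, None, None); (None, None, None)])%N.

(** Q_1 is generated by alpha, beta, gamma, and Q_2 by the two relations. [cx_diff1] marks in turn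
    each arrow of a relation, [cx_homotopy0] each arrow of a path; [cx_diff2] holds relations among
    relations. [cx_rank2] is empty because Hom(Q_2, A) -> Hom(Q_3, A) is zero. *)
Definition lambda1_complex : bimod_complex := {|
  cx_ids := [:: 0; 1]%N;
  cx_gens1 := [:: (1, 1); (0, 1); (1, 0)]%N;
  cx_gens2 := [:: (1, 1); (0, 0)]%N;
  cx_gens3 := [:: (0, 0); (1, 1)]%N;
  cx_diff0 := [:: [:: (1, (4, 1, 1)); (-1, (1, 1, 4))]; [:: (1, (2, 1, 1));
    (-1, (0, 0, 2))]; [:: (1, (3, 0, 0)); (-1, (1, 1, 3))]];
  cx_diff1 := [:: [:: (1, (1, 0, 4)); (1, (4, 0, 1)); (-1, (1, 2, 2));
    (-1, (3, 1, 1))]; [:: (1, (0, 1, 6)); (1, (2, 0, 3)); (1, (5, 2, 0))]];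
  cx_diff2 := [:: [:: (1, (8, 1, 0)); (-1, (0, 1, 8)); (1, (2, 0, 6));
    (-1, (5, 0, 3))]; [:: (1, (6, 1, 2)); (1, (13, 0, 1)); (-1, (11, 0, 4));
    (-1, (3, 1, 5)); (1, (4, 0, 11)); (-1, (1, 0, 13))]];
  cx_homotopy0 := [:: (0, 3, [:: (1, (1, 2, 0))]); (0, 6, [:: (1, (4, 2, 0));
    (1, (1, 0, 3))]); (0, 8, [:: (1, (2, 2, 0)); (1, (0, 1, 3))]);
    (0, 10, [:: (1, (7, 2, 0)); (1, (4, 0, 3)); (1, (1, 0, 6))]);
    (0, 12, [:: (1, (9, 2, 0)); (1, (5, 0, 3)); (1, (2, 0, 6));
    (1, (0, 1, 10))]); (1, 2, [:: (1, (0, 1, 1))]);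
    (1, 4, [:: (1, (1, 0, 1))]); (1, 5, [:: (1, (2, 0, 1)); (1, (0, 1, 4))]);
    (1, 7, [:: (1, (4, 0, 1)); (1, (1, 0, 4))]); (1, 9, [:: (1, (5, 0, 1));
    (1, (2, 0, 4)); (1, (0, 1, 7))]); (1, 11, [:: (1, (7, 0, 1));
    (1, (4, 0, 4)); (1, (1, 0, 7))]); (1, 13, [:: (1, (11, 0, 1));
    (1, (7, 0, 4)); (1, (4, 0, 7)); (1, (1, 0, 11))])];
  cx_homotopy1 := [:: (0, 9, [:: (1, (0, 1, 2)); (1, (5, 0, 1))]);
    (0, 13, [:: (1, (1, 0, 11)); (1, (3, 1, 2)); (1, (11, 0, 1))]);
    (1, 3, [:: (-1, (1, 0, 1))]); (1, 6, [:: (-1, (4, 0, 1))]);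
    (1, 8, [:: (-1, (2, 0, 1))]); (1, 10, [:: (-1, (7, 0, 1))]);
    (1, 12, [:: (1, (0, 1, 5)); (1, (5, 0, 4)); (-1, (9, 0, 1))]);
    (2, 5, [:: (1, (0, 1, 0))]); (2, 11, [:: (1, (1, 0, 6)); (1, (3, 1, 0))]);
    (2, 13, [:: (1, (6, 1, 0)); (1, (4, 0, 6))])];
  cx_homotopy2 := [:: (0, 13, [:: (1, (1, 1, 1))]);
    (1, 8, [:: (1, (0, 0, 0))]); (1, 10, [:: (1, (3, 0, 0))]);
    (1, 12, [:: (1, (8, 0, 0)); (1, (0, 0, 8))])];
  cx_rank0 := RankCert [:: [:: -1; 0; 0]; [:: 0; -1; 0]; [:: 0; 0; 0];
    [:: 1; 0; 0]; [:: 0; 0; 1]; [:: 0; 1; 0]; [:: 0; 0; 0]; [:: 0; 0; 0]]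
    [:: 1; 1; 1] [:: [:: 0; 0; 0; 0; 0; 1; 0; 0; -1; 0; 0];
    [:: 0; 0; 0; 0; 0; 0; 0; 1; 0; 0; -1];
    [:: 0; 0; 0; 0; 0; 0; 1; 0; 0; -1; 0]] [:: [:: -1; 0; 0; 0; 0; 0; 0; 0];
    [:: 0; -1; 0; 0; 0; 0; 0; 0]; [:: 0; 0; 0; 0; 1; 0; 0; 0]]
    [:: [:: 0; 0; 0]; [:: 0; 0; 0]; [:: 0; 0; 0]; [:: 0; 0; 0]; [:: 0; 0; 0];
    [:: 1; 0; 0]; [:: 0; 0; 1]; [:: 0; 1; 0]; [:: 0; 0; 0]; [:: 0; 0; 0];
    [:: 0; 0; 0]];
  cx_rank1 := RankCert [:: [:: 1; 0; 0; 0; 0]; [:: 0; 0; 2; 0; 0];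
    [:: 0; 1; 0; 0; 0]; [:: 0; 0; 0; 2; 0]; [:: 0; 0; 0; 0; 0];
    [:: 0; 0; -1; 0; 0]; [:: 0; 1; 0; 0; -1]; [:: 0; 0; 0; -1; 0];
    [:: 0; 0; -1; 0; 0]; [:: 0; 1; 0; 0; -1]; [:: 0; 0; 0; -1; 0]]
    [:: 1; 1; 1; 1; 3] [:: [:: 0; 2; 0; 0; 0; 0; 1; 0];
    [:: 0; 0; 0; 2; 0; 0; 0; 1]; [:: 0; 0; 1; 0; 0; 0; 0; 0];
    [:: 0; 0; 0; 0; 1; 0; 0; 0]; [:: 0; 0; 0; 1; 0; 0; 0; 0]]
    [:: [:: 1; 0; 0; 0; 0; 0; 0; 0; 0; 0; 0];
    [:: 0; 0; 1; 0; 0; 0; 0; 0; 0; 0; 0];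
    [:: 0; 0; 0; 0; 0; -1; 0; 0; 0; 0; 0];
    [:: 0; 0; 0; 0; 0; 0; 0; -1; 0; 0; 0];
    [:: 0; 0; 1; 0; 0; 0; -1; 0; 0; 0; 0]] [:: [:: 0; 0; 0; 0; 0];
    [:: 0; 0; 0; 0; 0]; [:: 0; 0; 1; 0; 0]; [:: 0; 0; 0; 0; 1];
    [:: 0; 0; 0; 1; 0]; [:: 0; 0; 0; 0; 0]; [:: 1; 0; 0; 0; 0];
    [:: 0; 1; 0; 0; -2]];
  cx_rank2 := RankCert [::] [::] [::] [::] [::]
|}.

Definition lambda2_words : seq (qpath lambda_quiver) :=
  [:: qp v1 [::]; qp v2 [::]; qp v1 [:: beta]; qp v2 [:: gamma];
  qp v2 [:: alpha]; qp v1 [:: beta; alpha]; qp v2 [:: alpha; gamma];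
  qp v2 [:: alpha; alpha]; qp v1 [:: beta; alpha; gamma];
  qp v2 [:: alpha; alpha; alpha]; qp v2 [:: alpha; alpha; alpha; alpha]].

Definition lambda2_step : seq (option nat * option nat * option nat) :=
  ([:: (None, Some 2, None); (Some 4, None, Some 3); (Some 5, None, None);
  (None, Some 9, None); (Some 7, None, Some 6); (None, None, Some 8);
  (None, Some 10, None); (Some 9, None, None); (None, None, None);
  (Some 10, None, None); (None, None, None)])%N.

(** Q_2 is generated by r_1 = alpha^2 gamma, r_2 = beta alpha^2, r_3 = beta gamma and r_4 = alpha^3
    - gamma beta. [cx_diff2] lists r_4 gamma - alpha r_1 + gamma r_3, beta r_4 + r_3 beta - r_2
    alpha, r_2 gamma - beta r_1 and alpha^2 r_4 - r_4 alpha^2 + r_1 beta - gamma r_2, all zero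
    already in KQ. *)
Definition lambda2_complex : bimod_complex := {|
  cx_ids := [:: 0; 1]%N;
  cx_gens1 := [:: (1, 1); (0, 1); (1, 0)]%N;
  cx_gens2 := [:: (1, 0); (0, 1); (0, 0); (1, 1)]%N;
  cx_gens3 := [:: (1, 0); (0, 1); (0, 0); (1, 1)]%N;
  cx_diff0 := [:: [:: (1, (4, 1, 1)); (-1, (1, 1, 4))]; [:: (1, (2, 1, 1));
    (-1, (0, 0, 2))]; [:: (1, (3, 0, 0)); (-1, (1, 1, 3))]];
  cx_diff1 := [:: [:: (1, (1, 0, 6)); (1, (4, 0, 3)); (1, (7, 2, 0))];
    [:: (1, (0, 1, 7)); (1, (2, 0, 4)); (1, (5, 0, 1))]; [:: (1, (0, 1, 3));
    (1, (2, 2, 0))]; [:: (1, (1, 0, 7)); (1, (4, 0, 4)); (1, (7, 0, 1));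
    (-1, (1, 2, 2)); (-1, (3, 1, 1))]];
  cx_diff2 := [:: [:: (1, (1, 3, 3)); (-1, (4, 0, 0)); (1, (3, 2, 0))];
    [:: (1, (2, 3, 1)); (1, (0, 2, 2)); (-1, (0, 1, 4))]; [:: (1, (0, 1, 3));
    (-1, (2, 0, 0))]; [:: (1, (7, 3, 1)); (-1, (1, 3, 7)); (1, (1, 0, 2));
    (-1, (3, 1, 1))]];
  cx_homotopy0 := [:: (0, 3, [:: (1, (1, 2, 0))]); (0, 6, [:: (1, (4, 2, 0));
    (1, (1, 0, 3))]); (0, 8, [:: (1, (5, 2, 0)); (1, (2, 0, 3));
    (1, (0, 1, 6))]); (1, 2, [:: (1, (0, 1, 1))]); (1, 4, [:: (1, (1, 0, 1))]);
    (1, 5, [:: (1, (2, 0, 1)); (1, (0, 1, 4))]); (1, 7, [:: (1, (4, 0, 1));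
    (1, (1, 0, 4))]); (1, 9, [:: (1, (7, 0, 1)); (1, (4, 0, 4));
    (1, (1, 0, 7))]); (1, 10, [:: (1, (9, 0, 1)); (1, (7, 0, 4));
    (1, (4, 0, 7)); (1, (1, 0, 9))])];
  cx_homotopy1 := [:: (0, 5, [:: (1, (0, 1, 1))]);
    (0, 10, [:: (1, (1, 3, 7)); (1, (3, 1, 1))]); (1, 3, [:: (-1, (1, 3, 1))]);
    (1, 6, [:: (-1, (4, 3, 1))]); (1, 8, [:: (1, (0, 1, 7)); (-1, (5, 3, 1))]);
    (2, 2, [:: (1, (0, 2, 0))]); (2, 7, [:: (1, (1, 0, 0))]);
    (2, 9, [:: (1, (4, 0, 0))]); (2, 10, [:: (1, (7, 0, 0))])];
  cx_homotopy2 := [:: (0, 2, [:: (-1, (0, 2, 0))]);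
    (0, 5, [:: (1, (0, 1, 3)); (-1, (2, 0, 0))]); (0, 9, [:: (-1, (3, 2, 0))]);
    (0, 10, [:: (1, (3, 1, 3)); (-1, (9, 0, 0))]); (1, 6, [:: (-1, (1, 0, 2));
    (-1, (4, 3, 1)); (1, (3, 1, 1))]); (1, 8, [:: (1, (0, 1, 9));
    (-1, (2, 0, 2)); (-1, (5, 3, 1))]); (2, 3, [:: (1, (1, 0, 0))]);
    (2, 6, [:: (1, (4, 0, 0))]); (2, 8, [:: (1, (5, 0, 0))]);
    (3, 2, [:: (1, (0, 1, 1))]); (3, 7, [:: (1, (1, 3, 1))]);
    (3, 9, [:: (-1, (1, 0, 2)); (1, (3, 1, 1))]); (3, 10, [:: (-1, (1, 0, 5));
    (1, (6, 1, 1)); (-1, (4, 3, 4)); (-1, (4, 0, 2)); (1, (3, 1, 4))])];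
  cx_rank0 := RankCert [:: [:: -1; 0]; [:: 0; 0]; [:: 1; 0]; [:: 0; 1];
    [:: 0; 0]; [:: 0; 0]; [:: 0; 0]] [:: 1; 1]
    [:: [:: 0; 0; 0; 0; 0; 1; 0; -1; 0]; [:: 0; 0; 0; 0; 0; 0; 1; 0; -1]]
    [:: [:: -1; 0; 0; 0; 0; 0; 0]; [:: 0; 0; 0; 1; 0; 0; 0]] [:: [:: 0; 0];
    [:: 0; 0]; [:: 0; 0]; [:: 0; 0]; [:: 0; 0]; [:: 1; 0]; [:: 0; 1];
    [:: 0; 0]; [:: 0; 0]];
  cx_rank1 := RankCert [:: [:: 0; 0; 1; 0]; [:: 3; 0; 0; 0]; [:: 0; 0; 0; 1];
    [:: 0; 0; 0; 0]; [:: 0; 0; 0; 0]; [:: -1; 0; 0; 0]; [:: 0; 1; 0; 0];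
    [:: -1; 0; 0; 0]; [:: 0; 1; 0; 0]] [:: 1; 1; 1; 3]
    [:: [:: 0; 0; 0; 0; 0; 0; 0; 0; 0; 1; 0];
    [:: 0; 0; 0; 0; 0; 1; 0; 0; 0; 0; -1];
    [:: 0; 2; 0; 2; 0; 0; 0; 0; 3; 0; 0]; [:: 0; 0; 0; 0; 0; 0; 0; 0; 0; 0; 1]]
    [:: [:: 0; 0; 0; 0; 0; -1; 0; 0; 0]; [:: 0; 0; 0; 0; 0; 0; 1; 0; 0];
    [:: 1; 0; 0; 0; 0; 0; 0; 0; 0]; [:: 0; 0; 1; 0; 0; 0; 0; 0; 0]]
    [:: [:: 0; 0; 0; 0]; [:: 0; 0; 0; 0]; [:: 0; 0; 0; 0]; [:: 0; 0; -1; 0];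
    [:: 0; 0; 0; 0]; [:: 0; 1; 0; 1]; [:: 0; 0; 0; 0]; [:: 0; 0; 0; 0];
    [:: 0; 0; 1; 0]; [:: 1; 0; 0; 0]; [:: 0; 0; 0; 1]];
  cx_rank2 := RankCert [:: [:: -1; 0; 0; 0]; [:: 0; -1; 0; 0];
    [:: 0; 0; -1; 0]; [:: 0; 1; 0; 0]; [:: 0; 0; 0; 1]; [:: 0; 0; 0; 0];
    [:: 0; 0; 0; 1]; [:: 1; 0; 1; 0]; [:: 0; 0; 0; 0]; [:: 0; 0; 0; 0];
    [:: 0; 0; 0; 0]] [:: 1; 1; 1; 1] [:: [:: 0; 1; 0; 0; 0; 0; 0; 0; 0; -1; 0];
    [:: 0; 0; 0; 0; 0; 1; 0; 0; 0; 0; -1];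
    [:: 0; 0; 0; 1; 0; 0; 0; 0; 0; 1; 0]; [:: 1; 0; 1; 0; 0; 0; 0; 0; 0; 0; 0]]
    [:: [:: -1; 0; 0; 0; 0; 0; 0; 0; 0; 0; 0];
    [:: 0; -1; 0; 0; 0; 0; 0; 0; 0; 0; 0];
    [:: 0; 0; -1; 0; 0; 0; 0; 0; 0; 0; 0];
    [:: 0; 0; 0; 0; 1; 0; 0; 0; 0; 0; 0]] [:: [:: 0; 0; 0; 0]; [:: 1; 0; 0; 0];
    [:: 0; 0; 0; 1]; [:: 0; 0; 1; 0]; [:: 0; 0; 0; 0]; [:: 0; 1; 0; 0];
    [:: 0; 0; 0; 0]; [:: 0; 0; 0; 0]; [:: 0; 0; 0; 0]; [:: 0; 0; 0; 0];
    [:: 0; 0; 0; 0]]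
|}.

Definition lambda1_rels : seq (qpath lambda_quiver * option (qpath lambda_quiver)) :=
  [:: (qp v2 [:: alpha; alpha], Some (qp v2 [:: gamma; beta]));
      (qp v1 [:: beta; alpha; gamma], None)].

Definition lambda2_rels : seq (qpath lambda_quiver * option (qpath lambda_quiver)) :=
  [:: (qp v2 [:: alpha; alpha; gamma], None);
      (qp v1 [:: beta; alpha; alpha], None);
      (qp v1 [:: beta; gamma], None);
      (qp v2 [:: alpha; alpha; alpha], Some (qp v2 [:: gamma; beta]))].


(** * Hochschild cohomology of the two algebras *)

Section LambdaHochschild.
Variables (K : fieldType) (A : falgType K).
Variable f : {linear path_algebra K lambda_quiver -> A}.
Hypothesis fM : forall y z, f (y * z) = f y * f z.
Hypothesis f1 : f 1 = 1.

Local Notation w0 := (qp v1 [::]).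
Local Notation e1 := (f (path_elt K (trivial_path (v1 : vertex lambda_quiver)))).
Local Notation e2 := (f (path_elt K (trivial_path (v2 : vertex lambda_quiver)))).
Local Notation a := (f (arrow_elt K (alpha : arrow lambda_quiver))).
Local Notation b := (f (arrow_elt K (beta : arrow lambda_quiver))).
Local Notation c := (f (arrow_elt K (gamma : arrow lambda_quiver))).

Section Presentation.
Variables (ws : seq (qpath lambda_quiver)).
Variable st : seq (option nat * option nat * option nat).
Variable rels : seq (qpath lambda_quiver * option (qpath lambda_quiver)).
Variable X : bimod_complex.
Local Notation m := (size ws).
Local Notation xs := (basis_tuple ws f).

Definition presentation_ok := [&&
  all (fun v => (lambda_iv v < m)%N && (nth w0 ws (lambda_iv v) == trivial_path v))
    [:: v1; v2],
  all (fun l : arrow lambda_quiver => all (fun i =>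
    if step_of st i l is Some j then
      [&& (j < m)%N, path_end (nth w0 ws i) == source l &
          path_end (nth w0 ws j) == target l]
    else true) (iota 0 m)) [:: alpha; beta; gamma],
  runs_ok w0 ws (step_of st) lambda_iv,
  rels_ok w0 ws (step_of st) rels,
  cx_ids X == [:: 0; 1]%N &
  bimod_complex_ok m (mul_table w0 ws (step_of st)) X].

Hypothesis f_surj : forall y, exists z, f z = y.
Hypothesis f_ker : forall y, f y = 0 <-> in_ideal [seq rel_elt K r | r <- rels] y.
Hypothesis stepE : forall i l, (i < m)%N ->
  xs`_i * f (arrow_elt K l) = oapp (fun j => xs`_j) 0 (step_of st i l).

Lemma lambda_HH k0 k1 k2 : presentation_ok ->
    cochain_dims m (mul_table w0 ws (step_of st)) X = (k0, k1, k2) ->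
  let r0 := cert_rank K (cx_rank0 X) in let r1 := cert_rank K (cx_rank1 X) in
  let r2 := cert_rank K (cx_rank2 X) in
  [/\ HH_dim A 0 (k0 - r0), HH_dim A 1 (k1 - r1 - r0) & HH_dim A 2 (k2 - r2 - r1)].
Proof.
case/and5P => /and3P[iv1 iv2 _] /and4P[sa sb sc _] run_ok rel_ok /andP[/eqP ids cx].
have iv_ok v : (lambda_iv v < m)%N && (nth w0 ws (lambda_iv v) == trivial_path v).
  by case: v.
have step_okb l : all (fun i => if step_of st i l is Some j then
    [&& (j < m)%N, path_end (nth w0 ws i) == source l &
        path_end (nth w0 ws j) == target l]
    else true) (iota 0 m) by case: l.
apply: (HH_dim_complex
  (basis_tupleP iv_ok step_okb run_ok rel_ok fM f1 f_surj f_ker stepE)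
  (basis_mul step_okb fM f1 stepE) (mul_table_lt step_okb (w0 := w0)) _ cx).
rewrite ids (basis_one iv_ok f1) !big_cons big_nil addr0.
rewrite (bigD1 (v1 : vertex lambda_quiver)) //= (bigD1 (v2 : vertex lambda_quiver)) //=.
by rewrite big1 ?addr0 // => -[].
Qed.

End Presentation.

Lemma lambda_zero : [/\ a * b = 0, b * b = 0, c * a = 0 & c * c = 0].
Proof. by rewrite -!fM !path_elt_mul0 // linear0. Qed.

Lemma f_path p : path_arrows p != [::] ->
  f (path_elt K p) = \prod_(l <- path_arrows p) f (arrow_elt K l).
Proof.
move=> pn; rewrite path_elt_arrows //; elim: (path_arrows p) => [|l u IHu].
  by rewrite !big_nil.
by rewrite !big_cons fM IHu.
Qed.

Lemma idem_arrow v (l : arrow lambda_quiver) :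
  f (path_elt K (trivial_path v)) * f (arrow_elt K l) =
  if source l == v then f (arrow_elt K l) else 0.
Proof.
rewrite -fM; case: eqP => [sl|/eqP nsl].
  by rewrite (path_elt_cat K (r := arrow_path l)).
by rewrite path_elt_mul0 ?linear0 // eq_sym.
Qed.

Lemma lambda1_basis : basis_tuple lambda1_words f =
  [:: e1; e2; b; c; a; b * a; a * c; a * a; b * c; b * a * a; a * a * c;
      a * a * a; b * a * a * c; a * a * a * a] :> seq A.
Proof.
do 2!congr (_ :: _); rewrite /= !f_path //= !big_cons !big_nil !mulr1.
by rewrite !mulrA.
Qed.

Lemma lambda2_basis : basis_tuple lambda2_words f =
  [:: e1; e2; b; c; a; b * a; a * c; a * a; b * a * c; a * a * a;
      a * a * a * a] :> seq A.
Proof.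
do 2!congr (_ :: _); rewrite /= !f_path //= !big_cons !big_nil !mulr1.
by rewrite !mulrA.
Qed.

Lemma lambda_zero_mul (y : A) :
  ((y * a * b = 0)%R * (y * b * b = 0)%R *
   (y * c * a = 0)%R * (y * c * c = 0)%R)%type.
Proof. by have [ab bb ca cc] := lambda_zero; rewrite -!mulrA ab bb ca cc mulr0. Qed.

(** The products leaving the list vanish: beta alpha^3 = beta alpha gamma beta = 0, alpha^3 gamma =
    gamma beta alpha gamma = 0 and alpha^5 = alpha^3 gamma beta = 0. *)
Lemma lambda1_step_mul : a * a = c * b -> b * a * c = 0 ->
  forall i l, (i < size lambda1_words)%N ->
  (basis_tuple lambda1_words f)`_i * f (arrow_elt K l) =
  oapp (fun j => (basis_tuple lambda1_words f)`_j) 0 (step_of lambda1_step i l).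
Proof.
move=> aa bac; have cb := esym aa; have [ab bb ca cc] := lambda_zero.
(* Products associate to the left, so that gamma beta is met behind a prefix [y]. *)
have ycb y : y * c * b = y * a * a by rewrite -mulrA -aa mulrA.
have baaa : b * a * a * a = 0 by rewrite -(ycb (b * a)) bac !mul0r.
have aaac : a * a * a * c = 0 by rewrite aa -!mulrA (mulrA b) bac mulr0.
have aaaac : a * a * a * a * c = 0 by rewrite -[RHS](mulr0 a) -aaac !mulrA.
have aaaaa : a * a * a * a * a = 0 by rewrite -(ycb (a * a * a)) aaac mul0r.
rewrite lambda1_basis => i [] /=.
all: by do 14?[case: i => [_|i]; first by rewrite /= ?idem_arrow ?lambda_zero_mul ?ycb
  ?(ab, bb, ca, cc, bac, baaa, aaac, aaaac, aaaaa, cb, mul0r)].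
Qed.

(** Here alpha^5 = alpha^2 gamma beta = 0, while alpha^3 gamma and alpha^4 gamma vanish with alpha^2
    gamma. *)
Lemma lambda2_step_mul :
    a * a * c = 0 -> b * a * a = 0 -> b * c = 0 -> a * a * a = c * b ->
  forall i l, (i < size lambda2_words)%N ->
  (basis_tuple lambda2_words f)`_i * f (arrow_elt K l) =
  oapp (fun j => (basis_tuple lambda2_words f)`_j) 0 (step_of lambda2_step i l).
Proof.
move=> aac baa bc aaa; have cb := esym aaa; have [ab bb ca cc] := lambda_zero.
have ycb y : y * c * b = y * a * a * a by rewrite -mulrA -aaa !mulrA.
have aaaac : a * a * a * a * c = 0 by rewrite -!mulrA (mulrA a a c) aac !mulr0.
have aaaaa : a * a * a * a * a = 0 by rewrite -(ycb (a * a)) aac mul0r.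
have aaac : a * a * a * c = 0 by rewrite -!mulrA (mulrA a a c) aac mulr0.
rewrite lambda2_basis => i [] /=.
all: by do 11?[case: i => [_|i]; first by rewrite /= ?idem_arrow ?lambda_zero_mul ?ycb
  ?(ab, bb, ca, cc, bc, baa, aac, aaac, aaaac, aaaaa, cb, mul0r)].
Qed.

Lemma lambda1_relationsE :
  lambda1_relations K = [seq rel_elt K r | r <- lambda1_rels].
Proof.
rewrite /lambda1_relations /rel_elt /= !path_elt_arrows //= !big_cons !big_nil.
by rewrite !mulr1 subr0 expr2 mulrA.
Qed.

Lemma lambda2_relationsE :
  lambda2_relations K = [seq rel_elt K r | r <- lambda2_rels].
Proof.
rewrite /lambda2_relations /rel_elt /= !path_elt_arrows //= !big_cons !big_nil.
by rewrite !mulr1 !subr0 !exprS expr0 !mulr1 !mulrA.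
Qed.

End LambdaHochschild.

Lemma pchar3 (K : fieldType) : (3%N \in [pchar K]) = (3%:~R == 0 :> K).
Proof. by []. Qed.

Lemma lambda1_HH (K : fieldType) (A : falgType K) :
    bound_quiver_algebra (lambda1_relations K) A ->
  [/\ HH_dim A 0 5, HH_dim A 1 (3 + (3%N \in [pchar K])) &
      HH_dim A 2 (3 + (3%N \in [pchar K]))].
Proof.
case=> f [[f1 fM] f_surj f_ker].
have rel0 i : (i < 2)%N -> f (nth 0 (lambda1_relations K) i) = 0.
  by move=> ilt; apply/f_ker/in_ideal_rel/mem_nth.
rewrite lambda1_relationsE in f_ker.
(* The dimensions of e_1 A e_1 and e_2 A e_2 are 3 and 5, those of e_1 A e_2 and e_2 A e_1 are 3; so
   8 = 3 + 5, 11 = 5 + 3 + 3 and 8 = 5 + 3. *)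
have [|||] := @lambda_HH K A f fM f1 lambda1_words lambda1_step lambda1_rels
  lambda1_complex f_surj f_ker _ 8 11 8.
- apply: (lambda1_step_mul fM f1).
    by apply/eqP; rewrite -subr_eq0 -!fM -linearB -expr2; exact/eqP/(rel0 0%N).
  by rewrite -!fM; apply: (rel0 1%N).
- by vm_compute.
- by vm_compute.
(* Every divisor is 1, except the 3 in [cx_rank1], which is counted unless the characteristic is
   3. *)
have oneK : 1%:~R != 0 :> K := oner_neq0 K.
by rewrite /cert_rank /= oneK pchar3; case: eqP.
Qed.

Lemma lambda2_HH (K : fieldType) (A : falgType K) :
    bound_quiver_algebra (lambda2_relations K) A ->
  [/\ HH_dim A 0 5, HH_dim A 1 (3 + (3%N \in [pchar K])) &
      HH_dim A 2 (3 + (3%N \in [pchar K]))].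
Proof.
case=> f [[f1 fM] f_surj f_ker].
have rel0 i : (i < 4)%N -> f (nth 0 (lambda2_relations K) i) = 0.
  by move=> ilt; apply/f_ker/in_ideal_rel/mem_nth.
rewrite lambda2_relationsE in f_ker.
(* Now e_2 A e_2 has dimension 5 and the three other corners have dimension 2; so 7 = 2 + 5, 9 = 5 +
   2 + 2 and 11 = 2 + 2 + 2 + 5. *)
have [|||] := @lambda_HH K A f fM f1 lambda2_words lambda2_step lambda2_rels
  lambda2_complex f_surj f_ker _ 7 9 11.
- apply: (lambda2_step_mul fM f1).
  + by rewrite -!fM -expr2; apply: (rel0 0%N).
  + by rewrite -!fM -mulrA -expr2; apply: (rel0 1%N).
  + by rewrite -!fM; apply: (rel0 2).
  by apply/eqP; rewrite -subr_eq0 -!fM -linearB -expr2 -exprSr; exact/eqP/(rel0 3).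
- by vm_compute.
- by vm_compute.
have oneK : 1%:~R != 0 :> K := oner_neq0 K.
by rewrite /cert_rank /= oneK pchar3; case: eqP.
Qed.

Theorem proposition6p1 (K : closedFieldType) (A : falgType K)
    (hA : bound_quiver_algebra (lambda1_relations K) A \/
          bound_quiver_algebra (lambda2_relations K) A) :
  [/\ HH_dim A 0 5,
      (3%N \notin [pchar K] -> HH_dim A 1 3) /\
      (3%N \in [pchar K] -> HH_dim A 1 4) &
      (3%N \notin [pchar K] -> HH_dim A 2 3) /\
      (3%N \in [pchar K] -> HH_dim A 2 4)].
Proof.
suff [h0 h1 h2] : [/\ HH_dim A 0 5, HH_dim A 1 (3 + (3%N \in [pchar K])) &
    HH_dim A 2 (3 + (3%N \in [pchar K]))].
  by split=> //; split=> [/negPf c3|c3]; rewrite c3 in h1 h2.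
by case: hA => [/lambda1_HH|/lambda2_HH].
Qed.
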